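(* Let $\Sigma\subset\mathbb R^2$ and $p\in[1,+\infty]$. (a) Assume that either $p<+\infty$ and $R\Sigma$ contains the graph of a universally measurable function $\varphi:\mathbb R\to\mathbb R$ with linear growth, or $p=+\infty$ and $R\Sigma$ contains the graph of a universally measurable function $\varphi:\mathbb R\to\mathbb R$ mapping bounded sets to bounded sets. Then, for every $(z_0,z_1)\in\mathsf X_p$, there exists a solution in $\mathsf X_p$ of the wave equation associated with $\Sigma$ with initial condition $(z_0,z_1)$. (b) Assume that, for every $(z_0,z_1)\in\mathsf X_p$, there exists a solution in $\mathsf X_p$ of the wave equation associated with $\Sigma$ with initial condition $(z_0,z_1)$. Then $R\Sigma$ contains the graph of a Lebesgue measurable function $\mathbb R\to\mathbb R$. Moreover, $R\Sigma$ also contains the graph of a function $\mathbb R\to\mathbb R$ with linear growth if $p<+\infty$, or the graph of a function $\mathbb R\to\mathbb R$ mapping bounded sets to bounded sets if $p=+\infty$.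
   Context: Notation: $\mathbb R_+=[0,+\infty)$, $R=\begin{pmatrix}\frac1{\sqrt2}&\frac1{\sqrt2}\\-\frac1{\sqrt2}&\frac1{\sqrt2}\end{pmatrix}$ and $R\Sigma=\{R\xi:\xi\in\Sigma\}$. $L^p_{\mathrm{loc}}(a,+\infty)$ is the set of measurable functions whose restriction to $(a,T)$ is in $L^p$ for every $T>a$. $W^{1,p}_*(0,1)=\{u\in L^p(0,1): u'\in L^p(0,1),\ u(0)=0\}$ and $\mathsf X_p=W^{1,p}_*(0,1)\times L^p(0,1)$. The wave equation associated with $\Sigma$ is: $z_{tt}=z_{xx}$ on $\mathbb R_+\times[0,1]$; $z(t,0)=0$ and $(z_t(t,1),-z_x(t,1))\in\Sigma$ for $t\in\mathbb R_+$; $z(0,x)=z_0(x)$, $z_t(0,x)=z_1(x)$ for $x\in[0,1]$. A (weak, global in time) solution in $\mathsf X_p$ with initial condition $(z_0,z_1)\in\mathsf X_p$ is a function $z:\mathbb R_+\times[0,1]\to\mathbb R$ for which there exist $f\in L^p_{\mathrm{loc}}(0,+\infty)$ and $g\in L^p_{\mathrm{loc}}(-1,+\infty)$ such that $z(t,x)=\frac1{\sqrt2}\int_0^{t+x}f+\frac1{\sqrt2}\int_0^{t-x}g$ for all $(t,x)\in\mathbb R_+\times[0,1]$, $z(t,0)=0$ and $(z_t(t,1),-z_x(t,1))\in\Sigma$ for a.e. $t\in\mathbb R_+$, and $z(0,x)=z_0(x)$, $z_t(0,x)=z_1(x)$ for a.e. $x\in[0,1]$; here $z_t(t,x)=\frac{f(t+x)+g(t-x)}{\sqrt2}$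 and $z_x(t,x)=\frac{f(t+x)-g(t-x)}{\sqrt2}$. A function $\varphi:\mathbb R\to\mathbb R$ has linear growth if there exist $a,b\in\mathbb R_+$ with $|\varphi(x)|\le a|x|+b$ for all $x\in\mathbb R$. A set $M\subset\mathbb R$ is universally measurable if for every Borel probability measure $\nu$ on $\mathbb R$ there exist Borel sets $A\subset M\subset B$ with $\nu(B\setminus A)=0$; a function $\varphi:\mathbb R\to\mathbb R$ is universally measurable if $\varphi^{-1}(B)$ is universally measurable for every Borel set $B\subset\mathbb R$. *)

(* Defs.v *)
From HB Require Import structures.
From mathcomp Require Import all_boot all_order all_algebra.
From mathcomp Require Import all_classical all_reals all_analysis.
Set Implicit Arguments.
Unset Strict Implicit.
Unset Printing Implicit Defensive.
Import Order.TTheory GRing.Theory Num.Theory.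
Import numFieldNormedType.Exports.
Local Open Scope classical_set_scope.
Local Open Scope ring_scope.

(* The real line with the sigma-algebra of Lebesgue measurable sets, on which
   [completed_lebesgue_measure] lives; [measurableTypeR R] and [R] itself carry
   the Borel sigma-algebra. *)
Notation lebesgueTypeR R := (caratheodory_type ((@wlength R idfun)^*)%mu).

Notation leb R := (@completed_lebesgue_measure R).

Definition lebesgue_measurable_fun (R : realType) (D : set R) (f : R -> R) :=
  @measurable_fun _ _ (lebesgueTypeR R) R D f.

(* Elements of L^p(D) are represented by functions on the whole line whose
   values outside D are ignored. The membership predicates and the notion of
   solution below do not depend on the representative up to null sets. *)
Definition in_Lp (R : realType) (p : \bar R) (D : set R) (f : R -> R) :=
  lebesgue_measurable_fun D f /\
  ('N[leb R]_p [EFin \o (f \_ D)] < +oo)%E.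

Definition in_Lp_loc (R : realType) (p : \bar R) (a : R) (f : R -> R) :=
  forall T : R, a < T -> in_Lp p `]a, T[ f.

Definition C1c01 (R : realType) (phi : R -> R) :=
  [/\ forall x : R, derivable phi x 1,
      continuous (derive1 phi) &
      exists a b : R, [/\ 0 < a, b < 1 &
        forall x : R, x \notin `[a, b] -> phi x = 0]].

Definition weak_derivative01 (R : realType) (u v : R -> R) :=
  forall phi : R -> R, C1c01 phi ->
    \int[leb R]_(x in `]0, 1[) (u x * derive1 phi x) =
    - \int[leb R]_(x in `]0, 1[) (v x * phi x).

(* The value at 0 of a class of W^{1,p}(0,1) is that of its continuous
   representative w. *)
Definition in_W1pstar (R : realType) (p : \bar R) (u : R -> R) :=
  [/\ in_Lp p `]0, 1[ u,
      exists v : R -> R, in_Lp p `]0, 1[ v /\ weak_derivative01 u v &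
      exists w : R -> R,
        [/\ {within `[0, 1], continuous w},
            {ae leb R, forall x : R, x \in `]0, 1[ -> u x = w x} &
            w 0 = 0]].

Definition Xp (R : realType) (p : \bar R) : set ((R -> R) * (R -> R)) :=
  [set z01 | in_W1pstar p z01.1 /\ in_Lp p `]0, 1[ z01.2].

(* The oriented integral from 0 to s, s of any sign. *)
Definition int0 (R : realType) (f : R -> R) (s : R) : R :=
  if 0 <= s then \int[leb R]_(y in `]0, s[) f y
  else - \int[leb R]_(y in `]s, 0[) f y.

Definition dalembert_t (R : realType) (f g : R -> R) (t x : R) : R :=
  (f (t + x) + g (t - x)) / Num.sqrt 2.

Definition dalembert_x (R : realType) (f g : R -> R) (t x : R) : R :=
  (f (t + x) - g (t - x)) / Num.sqrt 2.

Definition wave_solution (R : realType) (p : \bar R) (Sigma : set (R * R))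
    (z0 z1 : R -> R) (z : R -> R -> R) :=
  exists f g : R -> R,
    [/\ in_Lp_loc p 0 f /\ in_Lp_loc p (-1) g,
        forall t x : R, 0 <= t -> x \in `[0, 1] ->
          z t x = (Num.sqrt 2)^-1 * int0 f (t + x)
                  + (Num.sqrt 2)^-1 * int0 g (t - x),
        {ae leb R, forall t : R, 0 <= t ->
          z t 0 = 0 /\ Sigma (dalembert_t f g t 1, - dalembert_x f g t 1)} &
        {ae leb R, forall x : R, x \in `[0, 1] ->
          z 0 x = z0 x /\ dalembert_t f g 0 x = z1 x}].

Definition solvable_in_Xp (R : realType) (p : \bar R) (Sigma : set (R * R)) :=
  forall z0 z1 : R -> R, Xp p (z0, z1) ->
    exists z : R -> R -> R, wave_solution p Sigma z0 z1 z.

(* Multiplication by the matrix ((1, 1), (-1, 1)) / sqrt 2. *)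
Definition rotation (R : realType) (xi : R * R) : R * R :=
  ((Num.sqrt 2)^-1 * xi.1 + (Num.sqrt 2)^-1 * xi.2,
   - (Num.sqrt 2)^-1 * xi.1 + (Num.sqrt 2)^-1 * xi.2).

Definition fun_graph (R : realType) (phi : R -> R) : set (R * R) :=
  [set xy | xy.2 = phi xy.1].

Definition linear_growth (R : realType) (phi : R -> R) :=
  exists a b : R, [/\ 0 <= a, 0 <= b & forall x, `|phi x| <= a * `|x| + b].

Definition bounded_to_bounded (R : realType) (phi : R -> R) :=
  forall B : set R, bounded_set B -> bounded_set (phi @` B).

Definition universally_measurable (R : realType) (M : set R) :=
  forall nu : probability (measurableTypeR R) R,
    exists A B : set (measurableTypeR R),
      [/\ measurable A, measurable B, A `<=` M, M `<=` B & nu (B `\` A) = 0%E].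

Definition universally_measurable_fun (R : realType) (phi : R -> R) :=
  forall B : set (measurableTypeR R), measurable B ->
    universally_measurable (phi @^-1` B).

(* Main.v *)
Require Import Defs.
From HB Require Import structures.
From mathcomp Require Import all_boot all_order all_algebra.
From mathcomp Require Import all_classical all_reals all_analysis.
From mathcomp Require Import measurable_realfun ess_sup_inf.
From mathcomp Require Import lra ring.
Import Order.TTheory GRing.Theory Num.Theory.
Import numFieldNormedType.Exports.
Local Open Scope classical_set_scope.
Local Open Scope ring_scope.
Set Implicit Arguments.
Unset Strict Implicit.
Unset Printing Implicit Defensive.

(** Write [f] and [g] for the derivatives of the two travelling waves that make up
    a solution. The condition [z t 0 = 0] means that [f = - g] almost everywhere
    on the half-line, and [rotation] turns the condition at [x = 1] into: the pair
    [(g (t - 1), - f (t + 1)) = (g (t - 1), g (t + 1))] lies in the rotated set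
    for almost every [t >= 0] ([rotation_dalembert]). The wave equation is thus
    a delay relation between [g (t)] and [g (t + 2)]. The initial data are
    equivalent to the values of [g] on [(-1, 1)]: if [v] is the weak derivative
    of [z0], then [g (x) = - (v x + z1 x) / sqrt 2] and
    [g (- x) = (z1 x - v x) / sqrt 2] for [x] in [(0, 1)].

    Existence. If the rotated set contains the graph of [phi], define [g] on
    [(-1, 1)] from the data and extend it by [g (t + 2) = phi (g t)]
    ([solvable_of_superposition]). Universal measurability of [phi] is what makes
    [phi \o g] Lebesgue measurable for every Lebesgue measurable [g]
    ([universally_measurable_comp]), and the growth hypothesis keeps it in Lp. To
    recover [z0] from [g] one needs that [z0] is the primitive of its weak
    derivative; this follows from integration by parts against test functions,
    by Fubini ([weak_derivative_primitive]), and from the vanishing of the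
    derivative of the difference ([du_bois_reymond]).

    Necessity. Conversely, if the problem is solvable for all data, every [g0]
    of class Lp on [(-1, 1)] has a partner [g1] of class Lp with [(g0 t, g1 t)]
    in the rotated set for almost every [t] ([solvable_delay]). Testing
    this with suitable [g0] gives the selections. Constant functions show that
    all sections are nonempty. Functions [g0 t = c + t] give a measurable
    selection on [(c - 1, c + 1)] up to a null set, and these are glued and
    corrected by completeness of the measure. For the growth, take a selection
    of nearly minimal absolute value; if it grew too fast along a sequence
    [y k], then a step function with values [y k] on small disjoint blocks, of
    well chosen lengths, would be in Lp while none of its partners could be.

    Integrals here are taken against the completed Lebesgue measure. Its
    measurable sets lie between two Borel sets with null difference, and each
    of its measurable functions equals a Borel function almost everywhere
    ([leb_sandwich], [borel_representative]); this reduces questions about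
    primitives to the Borel case. *)

(** * The completed Lebesgue measure and the maps that preserve it *)
Section lebesgue_completion.
Context {R : realType}.
Local Notation LT := (lebesgueTypeR R).
Implicit Types (D E N : set LT).

Lemma borel_leb_measurable (A : set R) :
  measurable A -> measurable (A : set LT).
Proof. by move=> mA; exact: sub_caratheodory. Qed.

Lemma leb_negligible_measurable N : (leb R).-negligible N -> measurable N.
Proof. exact: negligible_sub_caratheodory. Qed.

(** The Caratheodory sigma-algebra of the Lebesgue outer measure is the
    completion of the Borel one. This is the only bridge between the two that
    the sequel uses. *)
Lemma leb_sandwich E : measurable E -> exists A B : set R,
  [/\ measurable A, measurable B, A `<=` E, E `<=` B & leb R (B `\` A) = 0%E].
Proof.
move=> mE.
have : (completed_algebra_gen (@lebesgue_measure R)).-sigma.-measurable E.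
  by rewrite completed_caratheodory_measurable.
rewrite g_sigma_completed_algebra_genE => -[A /= mA [N [F [mF F0 NF]]] <-].
exists A, (A `|` F); split => //.
- exact: measurableU.
- by apply: setUS.
- apply/eqP; rewrite eq_le measure_ge0 andbT -F0.
  apply: le_outer_measure => x [[]//].
Qed.

Lemma leb_negligible_borel N : (leb R).-negligible N ->
  exists B : set R, [/\ measurable B, leb R B = 0%E & N `<=` B].
Proof.
move=> [E [mE E0 NE]]; have [A [B [mA mB AE EB BA0]]] := leb_sandwich mE.
exists B; split => //; last exact: subset_trans EB.
apply/eqP; rewrite eq_le measure_ge0 andbT.
have mA' := borel_leb_measurable mA; have mB' := borel_leb_measurable mB.
have -> : 0%E = (leb R E + leb R (B `\` A))%E by rewrite E0 BA0 adde0.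
apply: le_trans (measureU2 (leb R) mE (measurableD mB' mA')).
apply: le_outer_measure => x Bx; have [/AE|] := pselect (A x); first by left.
by right.
Qed.

(** These two rules for almost-everywhere statements are proved on null sets, so
    that they apply to predicates on [R] as well as on [lebesgueTypeR R]. *)
Lemma leb_aeS (P Q : R -> Prop) : (forall x, P x -> Q x) ->
  {ae leb R, forall x, P x} -> {ae leb R, forall x, Q x}.
Proof. by move=> PQ; apply: negligibleS => x /=; apply: contra_not; exact: PQ. Qed.

Lemma leb_aeI (P Q : R -> Prop) : {ae leb R, forall x, P x} ->
  {ae leb R, forall x, Q x} -> {ae leb R, forall x, P x /\ Q x}.
Proof.
move=> nP nQ; apply: negligibleS (negligibleU nP nQ) => x /=.
by move=> /not_andP.
Qed.

(** Completeness of the measure: the preimages of a set under [f] on [D] and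
    under [g] on [E] differ, inside [E], by a subset of a null set. The domains
    are allowed to differ so that the same rule restricts functions, adds end
    points of intervals, and replaces a function by one that agrees with it
    almost everywhere. *)
Lemma leb_measurable_fun_ae d (T : measurableType d) D E (f g : LT -> T) :
  measurable D -> measurable E ->
  {ae leb R, forall x, E x -> D x /\ f x = g x} ->
  measurable_fun D f -> measurable_fun E g.
Proof.
move=> mD mE fg mf _ Y mY.
set P := fun x => E x -> D x /\ f x = g x in fg *.
have mP : measurable (~` [set x | P x]) by exact: leb_negligible_measurable.
rewrite (_ : E `&` _ =
  (E `&` (D `&` f @^-1` Y) `\` ~` [set x | P x]) `|`
  (~` [set x | P x] `&` (E `&` g @^-1` Y))).
  apply: measurableU.
    by apply: measurableD => //; apply: measurableI => //; exact: mf.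
  apply: leb_negligible_measurable; apply: negligibleS fg.
  exact: subIsetl.
apply/seteqP; split => [x [Ex Yx]|x [[[Ex [Dx Yx]] /contrapT Px]|[_ []//]]].
  have [Px|] := pselect (P x); [left|by right].
  have [Dx fgx] := Px Ex.
  split; last by apply.
  by split => //; split => //=; rewrite fgx.
by split => //=; rewrite -(Px Ex).2.
Qed.

(** Only Borel sets are mentioned, because that is what can be checked by
    comparing measures of intervals; Borel sandwiches extend both clauses to
    Lebesgue measurable sets. The maps in use are the translations and the
    reflection. *)
Definition leb_preserving (T : R -> R) := measurable_fun [set: R] T /\
  forall A : set R, measurable A -> leb R (T @^-1` A) = leb R A.

Lemma leb_preserving_negligible T N : leb_preserving T ->
  (leb R).-negligible N -> (leb R).-negligible (T @^-1` N).
Proof.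
move=> [mT TE] /leb_negligible_borel[B [mB B0 NB]].
exists (T @^-1` B); split; last exact: preimage_subset.
- apply: borel_leb_measurable; rewrite -[X in measurable X]setTI.
  exact: mT.
- by rewrite TE.
Qed.

Lemma leb_preserving_ae T (P : R -> Prop) : leb_preserving T ->
  {ae leb R, forall x, P x} -> {ae leb R, forall x, P (T x)}.
Proof. move=> TP; exact: leb_preserving_negligible. Qed.

(** Mere Borel measurability of [T] would not be enough here: a preimage of a
    null set must be null. *)
Lemma leb_preserving_measurable T : leb_preserving T ->
  measurable_fun setT (T : LT -> LT).
Proof.
move=> TP _ E mE; rewrite setTI.
have [A [B [mA mB AE EB BA0]]] := leb_sandwich mE.
rewrite (_ : _ @^-1` _ = T @^-1` A `|` T @^-1` (E `\` A)); last first.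
  by rewrite -preimage_setU setDUK.
apply: measurableU.
  apply: borel_leb_measurable; rewrite -[X in measurable X]setTI.
  exact: TP.1.
apply: leb_negligible_measurable; apply: leb_preserving_negligible => //.
exists (B `\` A); split => //; first by apply: borel_leb_measurable; exact: measurableD.
exact: setSD.
Qed.

Lemma leb_preserving_measure T E : leb_preserving T -> measurable E ->
  leb R (T @^-1` E) = leb R E.
Proof.
move=> TP mE; have [A [B [mA mB AE EB BA0]]] := leb_sandwich mE.
have mA' := borel_leb_measurable mA; have mB' := borel_leb_measurable mB.
have nEA : (leb R).-negligible (E `\` A).
  exists (B `\` A); split => //; first exact: measurableD.
  exact: setSD.
have mEA := measurableD mE mA'.
have EU : E = A `|` (E `\` A) by rewrite setDUK.
have mTA : measurable (T @^-1` A : set LT).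
  rewrite -[X in measurable X]setTI; exact: (leb_preserving_measurable TP).
have mTEA : measurable (T @^-1` (E `\` A) : set LT).
  rewrite -[X in measurable X]setTI; exact: (leb_preserving_measurable TP).
rewrite [in LHS]EU [in RHS]EU preimage_setU !measureU//.
- congr (_ + _)%E; first exact: TP.2.
  transitivity (0%E : \bar R); last apply/esym;
    apply/negligibleP => //; exact: leb_preserving_negligible.
- by rewrite setDIK.
- by rewrite -preimage_setI setDIK preimage_set0.
Qed.

Lemma leb_preservingN : leb_preserving -%R.
Proof.
split=> [|A mA]; first exact: oppr_measurable.
exact: lebesgue_measureN.
Qed.

Lemma leb_preservingD c : leb_preserving (+%R c).
Proof.
have mT : measurable_fun [set: R] (+%R c : R -> R).
  by apply: measurable_funD => //; exact: measurable_cst.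
split=> // A mA.
apply/esym.
apply: (@lebesgue_measure_unique _ (pushforward (@lebesgue_measure R)
  (+%R c : measurableTypeR R -> measurableTypeR R)) _ A mA) => _ [[a b]] _ <-.
transitivity (lebesgue_measure `]a - c, b - c]%classic).
  by rewrite !lebesgue_measure_itv/= !lte_fin ltrD2r -!EFinB opprB addrA addrNK.
rewrite /pushforward; congr lebesgue_measure.
by apply/seteqP; split=> x /=; rewrite !in_itv/= ltrBlDl lerBrDl.
Qed.

End lebesgue_completion.

(** * Change of variable and passage to Borel functions *)
Section lebesgue_integration.
Context {R : realType}.
Local Notation LT := (lebesgueTypeR R).
Implicit Types (D E N : set LT).

Lemma leb_itv (i : interval R) : leb R [set` i] = lebesgue_measure [set` i].
Proof. by []. Qed.

Lemma leb_oo_gt0 (a b : R) : a < b -> (0 < leb R `]a, b[)%E.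
Proof.
by move=> ab; rewrite leb_itv lebesgue_measure_itv/= lte_fin ab -EFinB lte_fin subr_gt0.
Qed.

Lemma ae_exists_oo (P : R -> Prop) (a b : R) : a < b ->
  {ae leb R, forall x, x \in `]a, b[ -> P x} -> exists2 x, x \in `]a, b[ & P x.
Proof.
move=> ab /leb_negligible_borel[B [mB B0 NB]].
apply/not_exists2P => noP.
have : (leb R `]a, b[ <= leb R B)%E.
  apply: le_outer_measure => x xab; apply: NB => /= /(_ xab) Px.
  by case: (noP x).
by rewrite B0 leNgt leb_oo_gt0.
Qed.

Lemma ae_lebesgue_leb (P : R -> Prop) :
  {ae lebesgue_measure, forall x, P x} -> {ae leb R, forall x, P x}.
Proof.
by move=> [N [mN N0 sN]]; exists N; split => //; exact: borel_leb_measurable.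
Qed.

Lemma leb_ge0_integral_comp T D (f : LT -> \bar R) : leb_preserving T ->
  measurable D -> measurable_fun D f -> (forall y, D y -> 0 <= f y)%E ->
  (\int[leb R]_(x in T @^-1` D) f (T x) = \int[leb R]_(x in D) f x)%E.
Proof.
move=> TP mD mf f0; have mT := leb_preserving_measurable TP.
have /= <- := @ge0_integral_pushforward _ _ _ _ _ (T : LT -> LT) mT (leb R) D f mD mf.
  by apply: eq_measure_integral => A mA _; exact: leb_preserving_measure.
by move=> y; rewrite inE => /f0.
Qed.

Lemma leb_Rintegral_comp T D (f : LT -> R) : leb_preserving T ->
  measurable D -> measurable_fun D f ->
  \int[leb R]_(x in T @^-1` D) f (T x) = \int[leb R]_(x in D) f x.
Proof.
move=> TP mD mf; rewrite /Rintegral; congr fine.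
have mEf : measurable_fun D (EFin \o f) by exact/measurable_EFinP.
rewrite [LHS]integralE [RHS]integralE; congr (_ - _)%E.
- have /= <- := @leb_ge0_integral_comp T D _ TP mD (measurable_funepos mEf)
    (fun x _ => funepos_ge0 _ x).
  by apply: eq_integral => x _;
    rewrite -[RHS]/(((EFin \o f)^\+ \o T) x)%E -funepos_comp.
- have /= <- := @leb_ge0_integral_comp T D _ TP mD (measurable_funeneg mEf)
    (fun x _ => funeneg_ge0 _ x).
  by apply: eq_integral => x _;
    rewrite -[RHS]/(((EFin \o f)^\- \o T) x)%E -funeneg_comp.
Qed.

(** The identity map pushes the completed measure forward to the Borel one. Hence
    the fundamental theorem of calculus and Lebesgue differentiation, which
    concern [lebesgue_measure], apply to [leb R]. *)
Lemma leb_ge0_integral_borel (D : set R) (f : R -> \bar R) :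
  measurable D -> measurable_fun D f -> (forall y, D y -> 0 <= f y)%E ->
  (\int[leb R]_(x in D) f x = \int[lebesgue_measure]_(x in D) f x)%E.
Proof.
move=> mD mf f0.
have mid : measurable_fun setT (idfun : LT -> measurableTypeR R).
  by move=> _ A mA; rewrite setTI; exact: borel_leb_measurable.
have /= <- := @ge0_integral_pushforward _ _ _ _ _
    (idfun : LT -> measurableTypeR R) mid (leb R) D f mD mf.
  by apply: eq_measure_integral.
by move=> y; rewrite inE => /f0.
Qed.

Lemma leb_integral_borel (D : set R) (f : R -> \bar R) :
  measurable D -> measurable_fun D f ->
  (\int[leb R]_(x in D) f x = \int[lebesgue_measure]_(x in D) f x)%E.
Proof.
move=> mD mf.
rewrite [LHS]integralE [RHS]integralE; congr (_ - _)%E.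
- exact: (leb_ge0_integral_borel mD (measurable_funepos mf)).
- exact: (leb_ge0_integral_borel mD (measurable_funeneg mf)).
Qed.

Lemma borel_leb_measurable_fun d (T : measurableType d) (D : set R) (f : R -> T) :
  measurable D -> measurable_fun D f -> measurable_fun (D : set LT) (f : LT -> T).
Proof. by move=> mD mf _ Y mY; apply: borel_leb_measurable; exact: mf. Qed.

Lemma leb_integrable_borel (D : set R) (f : R -> \bar R) :
  measurable D -> measurable_fun D f ->
  (leb R).-integrable D f <-> lebesgue_measure.-integrable D f.
Proof.
move=> mD mf; split=> /integrableP[_ foo]; apply/integrableP; split => //.
- by rewrite -leb_ge0_integral_borel//; exact: measurableT_comp.
- exact: borel_leb_measurable_fun.
- by rewrite leb_ge0_integral_borel//; exact: measurableT_comp.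
Qed.

(** For each rational [q] choose a Borel set [A q] inside the superlevel set of
    [f] above [q], of full measure in it. The supremum of the [q] with [x] in
    [A q] is a Borel function of [x], and it equals [f x] off the countable
    union of the exceptional sets. *)
Lemma borel_representative (f : LT -> R) : measurable_fun setT f ->
  exists2 f' : R -> R, measurable_fun setT f' & {ae leb R, forall x, f x = f' x}.
Proof.
move=> mf.
have /choice[A HA] (q : rat) : exists A : set R, [/\ measurable A,
    A `<=` [set x | ratr q < f x] &
    (leb R).-negligible ([set x | ratr q < f x] `\` A)].
  have mE : measurable ([set x | ratr q < f x] : set LT).
    rewrite (_ : mkset _ = setT `&` f @^-1` `]ratr q, +oo[%classic).
      exact: mf.
    by apply/seteqP; split=> x; rewrite /= in_itv/= andbT => // -[].
  have [A [B [mA mB AE EB BA0]]] := leb_sandwich mE.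
  exists A; split=> //; exists (B `\` A); split => //.
  - by apply: borel_leb_measurable; exact: measurableD.
  - exact: setSD.
pose F (x : R) : \bar R := ereal_sup [set (ratr q)%:E | q in [set q | A q x]].
have mF : measurable_fun setT F.
  apply: (measurability _ (ErealGenOInfty.measurableE R)) => // _ [_ [y ->] <-].
  rewrite setTI (_ : _ @^-1` _ =
      \bigcup_q (if y < ratr q then A q else set0)).
    by apply: bigcupT_measurable_rat => q; case: ifP => _; [have [] :=
      HA q|exact: measurable0].
  apply/seteqP; split=> x /=; rewrite in_itv/= andbT.
    move=> /ereal_sup_gt[_ [q Aqx <-]]; rewrite lte_fin => yq.
    by exists q => //; rewrite yq.
  move=> [q _]; case: ifPn => // yq Aqx.
  by apply: (@lt_le_trans _ _ (ratr q)%:E); [|apply: ereal_sup_ubound; exists q].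
exists (fine \o F); first exact: measurableT_comp.
have : (leb R).-negligible
    (\bigcup_q ([set x | ratr q < f x] `\` A q) : set LT).
  pose G n := if unpickle n is Some q then [set x | ratr q < f x] `\` A q
    else set0.
  apply: (@negligibleS _ _ _ _ (\bigcup_n G n)).
    move=> x [q _ qx].
    have [n nq] : exists n, unpickle n = Some q.
      by exists (pickle q); exact: pickleK.
    by exists n => //; rewrite /G nq.
  apply: negligible_bigcup => n; rewrite /G.
  by case: unpickle => [q|]; [have [] := HA q|exact: negligible_set0].
apply: negligibleS => x /= fFx; apply: contrapT => xN; apply: fFx.
suff -> : F x = (f x)%:E by [].
apply/eqP; rewrite eq_le; apply/andP; split.
  apply: ge_ereal_sup => _ [q Aqx <-]; rewrite lee_fin ltW//.
  by have [_ + _] := HA q; apply.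
rewrite leNgt; apply/negP => Ffx.
have F_fin : exists2 y : R, (F x <= y%:E)%E & y < f x.
  move: Ffx; case: (F x) => [r|//|_]; first by exists r.
  by exists (f x - 1); [exact: leNye|rewrite ltrBlDr ltrDl].
have [y Fy yf] := F_fin.
have [q] := rat_in_itvoo yf; rewrite in_itv/= => /andP[yq qf].
have [Aqx|Aqx] := pselect (A q x); last by apply: xN; exists q.
have : (F x < (ratr q)%:E)%E by rewrite (le_lt_trans Fy)// lte_fin.
by rewrite ltNge => /negP; apply; apply: ereal_sup_ubound; exists q.
Qed.

End lebesgue_integration.

(** * Primitives of integrable functions *)
Section primitives.
Context {R : realType}.
Local Notation LT := (lebesgueTypeR R).
Local Notation mu := (@lebesgue_measure R).

Lemma ae_eq_leb_Rintegral (D : set LT) (f g : LT -> R) : measurable D ->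
  measurable_fun D f -> measurable_fun D g ->
  {ae leb R, forall x, D x -> f x = g x} ->
  \int[leb R]_(x in D) f x = \int[leb R]_(x in D) g x.
Proof.
move=> mD mf mg fg; rewrite /Rintegral; congr fine.
have mEf : measurable_fun D (EFin \o f) by exact/measurable_EFinP.
have mEg : measurable_fun D (EFin \o g) by exact/measurable_EFinP.
have fgE : ae_eq (leb R) D (EFin \o f) (EFin \o g).
  by apply: leb_aeS fg => x fgx Dx; rewrite /= fgx.
exact: (@ae_eq_integral _ _ _ (leb R) D (EFin \o g) (EFin \o f) mD mEf mEg fgE).
Qed.

Lemma ae_eq_leb_integrable (D : set LT) (f g : LT -> R) : measurable D ->
  measurable_fun D g -> {ae leb R, forall x, D x -> f x = g x} ->
  (leb R).-integrable D (EFin \o f) -> (leb R).-integrable D (EFin \o g).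
Proof.
move=> mD mg fg /integrableP[mf foo].
have mEg : measurable_fun D (EFin \o g) by exact/measurable_EFinP.
apply/integrableP; split; first exact: mEg.
have mabse := @measurable_realfun.abse_measurable R setT.
have fgE : ae_eq (leb R) D (abse \o (EFin \o f)) (abse \o (EFin \o g)).
  by apply: leb_aeS fg => x fgx Dx; rewrite /= fgx.
have <- := @ge0_ae_eq_integral _ _ _ (leb R) D _ _ mD (measurableT_comp mabse mf)
  (measurableT_comp mabse mEg) (fun x _ => abse_ge0 _) (fun x _ => abse_ge0 _) fgE.
exact: foo.
Qed.

Lemma borel_integrable_representative (v : LT -> R) :
  (leb R).-integrable setT (EFin \o v) -> exists v' : R -> R,
  [/\ mu.-integrable setT (EFin \o v'), {ae leb R, forall x, v x = v' x} &
    forall D : set R, measurable D ->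
      \int[leb R]_(x in D) v x = \int[mu]_(x in D) v' x].
Proof.
move=> iv; have mv : measurable_fun setT v.
  by apply/measurable_EFinP; exact: measurable_int iv.
have [v' mv' vv'] := borel_representative mv.
have mv'L : measurable_fun setT (v' : LT -> R) by exact: borel_leb_measurable_fun.
exists v'; split => //.
- apply/leb_integrable_borel; [exact: measurableT|exact/measurable_EFinP|].
  apply: ae_eq_leb_integrable iv; [exact: measurableT|exact: mv'L|].
  by apply: leb_aeS vv' => x ->.
- move=> D mD.
  rewrite (@ae_eq_leb_Rintegral _ _ v')//.
  + rewrite /Rintegral leb_integral_borel//.
    by apply/measurable_EFinP; exact: measurable_funS mv'.
  + exact: borel_leb_measurable.
  + exact: measurable_funS mv.
  + exact: measurable_funS mv'L.
  + by apply: leb_aeS vv'.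
Qed.

(** A primitive of a Lebesgue measurable function is also the primitive of a Borel
    function, to which the regularity theorems for [parameterized_integral]
    apply. *)
Lemma borel_primitive (v : LT -> R) (b : R) :
  (leb R).-integrable `]0, b[ (EFin \o v) -> exists v' : R -> R,
  [/\ mu.-integrable setT (EFin \o v'),
    {ae leb R, forall x, x \in `]0, b[ -> v x = v' x} &
    forall x : R, x <= b ->
      \int[leb R]_(y in `]0, x[) v y = parameterized_integral mu 0 x v'].
Proof.
move=> iv; pose k : LT -> R := v \_ `]0, b[.
have mD : measurable (`]0, b[%classic : set LT) by exact: borel_leb_measurable.
have ik : (leb R).-integrable setT (EFin \o k).
  by rewrite /k -restrict_EFin; apply/integrable_restrict => //; rewrite setTI.
have [v' [iv' kv' kE]] := borel_integrable_representative ik.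
exists v'; split=> // [|x xb].
  by apply: leb_aeS kv' => x <- xb; rewrite /k patchE mem_set.
transitivity (\int[leb R]_(y in `]0, x[) k y).
  apply: eq_Rintegral => y; rewrite inE/= in_itv/= => /andP[y0 yx].
  by rewrite /k patchE mem_set//= in_itv/= y0 (lt_le_trans yx).
rewrite kE// /parameterized_integral Rintegral_itv_obnd_cbnd.
  by apply: Rintegral_itv_bndo_bndc; apply: integrableS iv'.
by apply: integrableS iv'.
Qed.

Lemma primitive_continuous (v : LT -> R) (b : R) : 0 <= b ->
  (leb R).-integrable `]0, b[ (EFin \o v) ->
  {within `[0, b], continuous (fun x => \int[leb R]_(y in `]0, x[) v y)}.
Proof.
move=> b0 /borel_primitive[v' [iv' _ vE]].
have : {within `[0, b], continuous (fun x => parameterized_integral mu 0 x v')}.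
  by apply: parameterized_integral_continuous => //; apply: integrableS iv'.
apply: subspace_eq_continuous => x; rewrite inE/= in_itv/= => /andP[_ xb].
exact/esym/vE.
Qed.

Lemma continuous_ae_eq (f g : R -> R) (a b : R) : a < b ->
  {within `[a, b], continuous f} -> {within `[a, b], continuous g} ->
  {ae leb R, forall x, x \in `]a, b[ -> f x = g x} ->
  forall x, x \in `[a, b] -> f x = g x.
Proof.
move=> ab /subspace_continuousP cf /subspace_continuousP cg fg x xab.
apply: contrapT => /eqP; rewrite -subr_eq0 => fgx.
have cfx : f y @[y --> within `[a, b] (nbhs x)] --> f x by exact: cf.
have cgx : g y @[y --> within `[a, b] (nbhs x)] --> g x by exact: cg.
have cfg : (f y - g y) @[y --> within `[a, b] (nbhs x)] --> f x - g x.
  exact: cvgB.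
have /nbhs_ballP[e /= e0 xe] : nbhs x (fun y => y \in `[a, b] -> f y - g y != 0).
  exact: (cvgr_neq0 _ cfg fgx).
move: (xab); rewrite in_itv/= => /andP[ax xb].
have : Num.max a (x - e) < Num.min b (x + e).
  rewrite gt_max !lt_min ab/= ltrBlDr; apply/and3P; split.
  - by rewrite (le_lt_trans ax)// ltrDl.
  - by rewrite (le_lt_trans xb)// ltrDl.
  - by rewrite ltrBlDr -addrA ltrDl addr_gt0.
move=> mm; have [|y] := @ae_exists_oo _ (fun y => y \in `]a, b[ -> f y = g y) _ _ mm.
  by apply: leb_aeS fg => y yP _.
rewrite in_itv/= gt_max lt_min => /andP[/andP[ay ey] /andP[yb ye]] fgy.
have yab : y \in `]a, b[ by rewrite in_itv/= ay.
have /xe : ball x e y.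
  by rewrite /ball/= ltr_norml; apply/andP; split; rewrite ?ltrBrDl ?ltrBlDl; lra.
by rewrite fgy// subrr eqxx in_itv/= !ltW// => /(_ isT).
Qed.

(** The primitive is continuous and vanishes almost everywhere, hence everywhere;
    by Lebesgue differentiation its derivative is [h] almost everywhere. *)
Lemma ae_eq0_primitive (h : LT -> R) (b : R) :
  (leb R).-integrable `]0, b[ (EFin \o h) ->
  {ae leb R, forall x, x \in `]0, b[ -> \int[leb R]_(y in `]0, x[) h y = 0} ->
  {ae leb R, forall x, x \in `]0, b[ -> h x = 0}.
Proof.
move=> ih h0.
have [b0|b0] := leP b 0.
  by apply: aeW => x; rewrite in_itv/= => /andP[/lt_trans] /[apply]; rewrite ltNge b0.
have [k' [ik' hk' kE]] := borel_primitive ih.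
pose F := fun x => parameterized_integral mu 0 x k'.
have F0 x : x \in `[0, b] -> F x = 0.
  apply: (@continuous_ae_eq F (cst 0) 0 b) => //.
  - by apply: parameterized_integral_continuous; [exact: ltW|apply: integrableS ik'].
  - by apply: continuous_subspaceT; exact: cst_continuous.
  - apply: leb_aeS h0 => y /[swap] yb /(_ yb) <-.
    by rewrite kE//; move: yb; rewrite in_itv/= => /andP[_ /ltW].
have lk : locally_integrable [set: R] k'.
  by have := @integrable_locally _ k' setT measurableT ik'; rewrite patch_setT.
have iy y : mu.-integrable [set` Interval (BLeft 0) (BRight y)] (EFin \o k').
  by apply: integrableS ik'.
have Fd : {ae leb R, forall x : R, 0 < x -> derive1 F x = k' x}.
  apply: leb_aeS (ae_lebesgue_leb (FTC1 iy lk)) => x Fx x0.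
  by apply: (Fx _).2; rewrite lte_fin.
apply: leb_aeS (leb_aeI hk' Fd) => x [hx Fx] xb; move: (xb).
rewrite in_itv/= => /andP[x0 _]; rewrite hx// -Fx// derive1E.
rewrite (@near_eq_derive _ _ _ F (cst 0)) ?derive_cst//.
near=> y; apply: F0; apply: subset_itv_oo_cc; near: y.
exact: near_in_itvoo.
Unshelve. all: by end_near. Qed.

End primitives.

(** * Fubini on a half-plane *)
Section triangle_fubini.
Context {R : realType}.
Local Notation mu := (@lebesgue_measure R).

(** The two sides are the iterated integrals of [p x * q y] over the half-plane
    [y < x]. This is integration by parts for absolutely continuous functions,
    once one factor is the derivative of a test function. *)
Lemma triangle_fubini (p q : R -> R) :
  mu.-integrable setT (EFin \o p) -> mu.-integrable setT (EFin \o q) ->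
  \int[mu]_x (p x * \int[mu]_(y in `]-oo, x[) q y) =
  \int[mu]_y (q y * \int[mu]_(x in `]y, +oo[) p x).
Proof.
move=> ip iq.
have mp : measurable_fun setT p by apply/measurable_EFinP; exact: measurable_int ip.
have mq : measurable_fun setT q by apply/measurable_EFinP; exact: measurable_int iq.
pose K (z : measurableTypeR R * measurableTypeR R) : R :=
  if z.2 < z.1 then p z.1 * q z.2 else 0.
have mK : measurable_fun setT K.
  apply: measurable_fun_if => //.
  - by apply: measurable_fun_ltr; [exact: measurable_snd|exact: measurable_fst].
  - apply: measurable_funM; apply: measurable_funTS; apply: measurableT_comp => //.
have KE1 x : (\int[mu]_y (K (x, y))%:E = (p x * \int[mu]_(y in `]-oo, x[) q y)%:E)%E.
  rewrite EFinM /Rintegral fineK; last first.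
    by apply: integrable_fin_num => //; apply: integrableS iq.
  rewrite -integralZl//; last by apply: integrableS iq.
  rewrite [RHS]integral_mkcond; apply: eq_integral => y _.
  by rewrite patchE /K /= mem_setE in_itv/=; case: ifP.
have KE2 y : (\int[mu]_x (K (x, y))%:E = (q y * \int[mu]_(x in `]y, +oo[) p x)%:E)%E.
  rewrite EFinM /Rintegral fineK; last first.
    by apply: integrable_fin_num => //; apply: integrableS ip.
  rewrite -integralZl//; last by apply: integrableS ip.
  rewrite [RHS]integral_mkcond; apply: eq_integral => x _.
  by rewrite patchE /K /= mem_setE in_itv/= andbT; case: ifP => // _; rewrite mulrC.
have mEK : measurable_fun setT (EFin \o K) by exact/measurable_EFinP.
have iK : (mu \x mu)%E.-integrable setT (EFin \o K).
  apply/integrable12ltyP => //.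
  have iq' : mu.-integrable setT (fun y => `|(q y)%:E|%E).
    by have := integrable_abse iq.
  have Iq0 : (0 <= \int[mu]_y `|(q y)%:E|)%E by apply: integral_ge0 => y _;
    exact: abse_ge0.
  have mabs (h : R -> R) :
    measurable_fun setT h -> measurable_fun setT (fun x => `|(h x)%:E|%E).
    by move=> mh; do 2 apply: measurableT_comp => //.
  apply: (@le_lt_trans _ _ (\int[mu]_x (`|(p x)%:E| * \int[mu]_y `|(q y)%:E|)%E)%E).
    apply: ge0_le_integral => //.
    - by move=> x _; apply: integral_ge0 => y _; exact: abse_ge0.
    - apply: (measurable_fun_fubini_tonelli_F (abse \o (EFin \o K))) => //=.
      exact: measurableT_comp.
    - by apply: emeasurable_funM => //; exact: mabs.
    - move=> x _; have -> :=
        esym (@ge0_integralZl _ _ _ mu setT measurableT _ (mabs _ mq)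
        `|(p x)%:E|%E (fun y _ => abse_ge0 _) (abse_ge0 _)).
      apply: ge0_le_integral => //.
      + by apply: mabs; exact: (@measurableT_comp _ _ _ _ _ _ K _ (pair x)).
      + by apply: emeasurable_funM => //; exact: mabs.
      + move=> y _ /=; rewrite /K/= -EFinM lee_fin.
        by case: ifP => _; rewrite ?normrM// normr0 mulr_ge0.
  rewrite (@ge0_integralZr _ _ _ mu setT measurableT _ (mabs _ mp) _
    (fun x _ => abse_ge0 _) Iq0).
  apply: lte_mul_pinfty => //.
    + by apply: integral_ge0 => y _; exact: abse_ge0.
    + rewrite ge0_fin_numE; last by apply: integral_ge0 => y _; exact: abse_ge0.
      by move/integrableP : ip => [].
    + by move/integrableP : iq => [].
rewrite /Rintegral; congr fine.
under eq_integral => x _ do rewrite -KE1.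
under [RHS]eq_integral => y _ do rewrite -KE2.
exact: (Fubini iK).
Qed.
End triangle_fubini.

(** * Tent-shaped test functions *)
Section weak_derivatives.
Context {R : realType}.
Local Notation LT := (lebesgueTypeR R).
Local Notation mu := (@lebesgue_measure R).

Lemma within_continuous_integrable (f : R -> R) (a b : R) (D : set R) :
  {within `[a, b], continuous f} -> measurable D -> D `<=` `[a, b] ->
  mu.-integrable D (EFin \o f).
Proof.
move=> cf mD Dab; have : mu.-integrable `[a, b] (EFin \o f).
  by apply: continuous_compact_integrable => //; exact: segment_compact.
by move=> /integrableS; apply.
Qed.

Lemma within_continuousT (f : R -> R) (A : set R) :
  continuous f -> {within A, continuous f}.
Proof. by move=> cf; apply: continuous_subspaceT. Qed.

(** The test function vanishes at [1]. *)
Lemma C1c01_integral_derive (phi : R -> R) (y : R) : C1c01 phi -> y < 1 ->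
  \int[mu]_(x in `]y, 1[) derive1 phi x = - phi y.
Proof.
move=> [dphi cphi [a [b [a0 b1 phi0]]]] y1.
have cphi' : {within `[y, 1], continuous (derive1 phi)} by exact: within_continuousT.
have dcphi : derivable_oo_LRcontinuous phi y 1.
  have cp (z : R) : {for z, continuous phi}.
    by apply/differentiable_continuous/derivable1_diffP.
  split=> [x _//||]; [apply: cvg_at_right_filter|apply: cvg_at_left_filter]; exact: cp.
have := continuous_FTC2 y1 cphi' dcphi (fun _ _ => erefl).
rewrite Rintegral_itv_obnd_cbnd; last first.
  apply: (within_continuous_integrable cphi') => //.
  exact: subset_itv_oo_cc.
rewrite Rintegral_itv_bndo_bndc; last first.
  apply: (within_continuous_integrable cphi') => //.
  exact: subset_itv_co_cc.
rewrite /Rintegral => ->; rewrite (phi0 1) ?sub0e//.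
by rewrite in_itv/= negb_and -!ltNge b1 orbT.
Qed.

(** The primitive of the positive part; it is the building block of explicit C^1
    functions with piecewise affine derivative. *)
Definition sqpos (x : R) : R := x * Num.max x 0 / 2.

Lemma continuous_max0 : continuous (fun x : R => Num.max x 0).
Proof.
move=> x; apply: (@continuous_max _ _ (@idfun R) (cst 0)); first exact: cvg_id.
exact: cvg_cst.
Qed.

Lemma is_derive_sqpos (x : R) : is_derive x 1 sqpos (Num.max x 0).
Proof.
have [x0|x0|->] := ltgtP x 0.
- have D0 : is_derive x 1 (cst 0 : R -> R) 0 by exact: is_derive_cst.
  have E0 : \near x, cst 0 x = sqpos x.
    near=> y; rewrite /sqpos max_r ?mulr0 ?mul0r//.
    by apply: ltW; near: y; exact: lt_nbhsl.
  exact: near_eq_is_derive E0 D0.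
- have D0 : is_derive x 1 (2^-1 *: ((@idfun R) * (@idfun R))) x.
    by apply: is_derive_eq; rewrite /GRing.scale/= !mulr1; lra.
  have E0 : \near x, (2^-1 *: ((@idfun R) * (@idfun R))) x = sqpos x.
    near=> y; have y0 : 0 <= y by apply: ltW; near: y; exact: lt_nbhsr.
    by rewrite /sqpos max_l// [RHS]mulrC.
  exact: near_eq_is_derive E0 D0.
- apply/is_derive1_caratheodory; exists (fun y => Num.max y 0 / 2); split.
  + by move=> y; rewrite /sqpos !mul0r !subr0; ring.
  + by apply: cvgMl; exact: continuous_max0.
  + by rewrite maxxx mul0r.
Unshelve. all: by end_near. Qed.

(** The graph is a triangle over [[-d, d]], with apex [d] at the origin. *)
Definition tent (d x : R) : R :=
  Num.max (x + d) 0 - 2 * Num.max x 0 + Num.max (x - d) 0.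

Definition tent_primitive (d x : R) : R :=
  sqpos (x + d) - 2 * sqpos x + sqpos (x - d).

Lemma tent_eq0 d x : 0 <= d -> d <= `|x| -> tent d x = 0.
Proof.
move=> d0; rewrite ler_normr /tent !maxEle => xd.
by case: (leP (x + d) 0) => ?; case: (leP x 0) => ?; case: (leP (x - d) 0) =>
  ?; move: xd => /orP[|] xd; lra.
Qed.

Lemma tent_gt0 d x : `|x| < d -> 0 < tent d x.
Proof.
rewrite ltr_norml /tent !maxEle => /andP[dx xd].
by case: (leP (x + d) 0) => ?; case: (leP x 0) => ?; case: (leP (x - d) 0) => ?; lra.
Qed.

Lemma tent_ge0 d x : 0 <= d -> 0 <= tent d x.
Proof.
move=> d0; have [dx|xd] := leP d `|x|; first by rewrite tent_eq0.
exact/ltW/tent_gt0.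
Qed.

Lemma tent_primitive_left d x : 0 <= d -> x <= - d -> tent_primitive d x = 0.
Proof.
move=> d0 xd; rewrite /tent_primitive /sqpos !max_r; lra.
Qed.

Lemma tent_primitive_right d x : 0 <= d -> d <= x -> tent_primitive d x = d ^+ 2.
Proof.
move=> d0 xd; rewrite /tent_primitive /sqpos !max_l; [|lra..].
by field.
Qed.

Lemma is_derive_tent d c (x : R) :
  is_derive x 1 (fun y => tent_primitive d (y - c)) (tent d (x - c)).
Proof.
have D0 e : is_derive x 1 (fun y => sqpos (y + e)) (Num.max (x + e) 0).
  have := @is_derive1_comp _ sqpos (fun y => y + e) x _ 1 (is_derive_sqpos _) _.
  by rewrite mulr1; apply; apply: is_derive_eq; rewrite addr0.
have -> : (fun y => tent_primitive d (y - c)) =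
    (fun y => sqpos (y + (d - c))) - 2 *: (fun y => sqpos (y - c)) +
    (fun y => sqpos (y + (- d - c))).
  apply/funext => y; rewrite /tent_primitive !fctE.
  by congr (sqpos _ - _ + sqpos _); lra.
rewrite /tent.
rewrite (_ : x - c + d = x + (d - c)); last by lra.
rewrite (_ : x - c - d = x + (- d - c)); last by lra.
by apply: is_derive_eq.
Qed.

Lemma continuous_tent d : continuous (tent d).
Proof.
move=> x; rewrite /tent; apply: cvgD; first apply: cvgB.
- apply: (@continuous_comp _ _ _ (fun y => y + d) (fun y => Num.max y 0)).
    by apply: cvgD; [exact: cvg_id|exact: cvg_cst].
  exact: continuous_max0.
- by apply: cvgMr; exact: continuous_max0.
- apply: (@continuous_comp _ _ _ (fun y => y - d) (fun y => Num.max y 0)).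
    by apply: cvgD; [exact: cvg_id|exact: cvg_cst].
  exact: continuous_max0.
Qed.

(** Difference of two translates of a smoothed step: it has compact support, and
    its derivative is a tent at [x1] minus a tent at [x2]. *)
Definition tent_bump d x1 x2 (x : R) : R :=
  tent_primitive d (x - x1) - tent_primitive d (x - x2).

Lemma derive1_tent_bump d x1 x2 :
  derive1 (tent_bump d x1 x2) = (fun x => tent d (x - x1) - tent d (x - x2)).
Proof.
apply/funext => x; rewrite derive1E.
have D1 := is_derive_tent d x1 x; have D2 := is_derive_tent d x2 x.
exact: derive_val.
Qed.

Lemma tent_bump_C1c01 d x1 x2 : 0 < d -> d < x1 -> x1 < 1 - d -> d < x2 -> x2 < 1 - d ->
  C1c01 (tent_bump d x1 x2).
Proof.
move=> d0 dx1 x1d dx2 x2d; split.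
- move=> x; have D1 := is_derive_tent d x1 x; have D2 := is_derive_tent d x2 x.
  exact: ex_derive.
- rewrite derive1_tent_bump => x; apply: cvgB.
    apply: (@continuous_comp _ _ _ (fun y => y - x1) (tent d)).
      by apply: cvgB; [exact: cvg_id|exact: cvg_cst].
    exact: continuous_tent.
  apply: (@continuous_comp _ _ _ (fun y => y - x2) (tent d)).
    by apply: cvgB; [exact: cvg_id|exact: cvg_cst].
  exact: continuous_tent.
- exists (Num.min (x1 - d) (x2 - d)), (Num.max (x1 + d) (x2 + d)); split.
  + by rewrite lt_min; apply/andP; split; lra.
  + by rewrite gt_max; apply/andP; split; lra.
  + move=> x; rewrite in_itv/= negb_and -!ltNge lt_min gt_max => /orP[]/andP[xl xr].
      by rewrite /tent_bump !tent_primitive_left ?subr0; lra.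
    by rewrite /tent_bump !tent_primitive_right ?subrr; lra.
Qed.

End weak_derivatives.

(** * Weak derivatives on the unit interval *)
Section du_bois_reymond.
Context {R : realType}.
Local Notation LT := (lebesgueTypeR R).
Local Notation mu := (@lebesgue_measure R).

Lemma continuous_bounded_on (f : R -> R) (a b : R) (D : set R) :
  continuous f -> D `<=` `[a, b] -> [bounded f x | x in D].
Proof.
move=> cf Dab.
have [M [Mr MP]] := compact_bounded (continuous_compact
  (continuous_subspaceT cf) (@segment_compact R a b)).
by exists M; split => // N MN x Dx; apply: (MP _ MN); exists x => //; exact: Dab.
Qed.

Lemma integrableM_continuous (f g : R -> R) (a b : R) (D : set R) :
  measurable D -> D `<=` `[a, b] -> mu.-integrable D (EFin \o f) -> continuous g ->
  mu.-integrable D (EFin \o (fun x => f x * g x)).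
Proof.
move=> mD Dab intf cg.
have mg : measurable_fun D g.
  by apply: measurable_funTS; exact: continuous_measurable_fun.
have := @integrableMl _ (measurableTypeR R) R mu D mD _ _ intf mg (continuous_bounded_on cg Dab).
by apply: eq_integrable => // x _ /=; rewrite EFinM.
Qed.

(** Fubini turns the integral of [V * phi'] into that of [v y] times the integral
    of [phi'] over [(y, 1)], which is [- phi y]. *)
Lemma weak_derivative_primitive (v : LT -> R) :
  (leb R).-integrable `]0, 1[ (EFin \o v) ->
  weak_derivative01 (fun x => \int[leb R]_(y in `]0, x[) v y) v.
Proof.
move=> iv phi Cphi; have [dphi cphi _] := Cphi.
have m01 : measurable (`]0, 1[%classic : set R) by exact: measurable_itv.
have m01L : measurable (`]0, 1[%classic : set LT) by exact: borel_leb_measurable.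
have [k' [ik' vk' kE]] := borel_primitive iv.
have mk' : measurable_fun setT k' by apply/measurable_EFinP; exact: measurable_int ik'.
have mphi' : measurable_fun setT (derive1 phi) by exact: continuous_measurable_fun.
have cphi0 : continuous phi.
  by move=> z; apply/differentiable_continuous/derivable1_diffP.
have mphi : measurable_fun setT phi by exact: continuous_measurable_fun.
pose W x := parameterized_integral mu 0 x k'.
have cW : {within `[0, 1], continuous W}.
  by apply: parameterized_integral_continuous => //; apply: integrableS ik'.
have mW : measurable_fun (`]0, 1[%classic : set R) W.
  apply: subspace_continuous_measurable_fun => //.
  by apply: continuous_subspaceW cW; exact: subset_itv_oo_cc.
have VE x : x \in `]0, 1[ -> \int[leb R]_(y in `]0, x[) v y = W x.
  by rewrite in_itv/= => /andP[_ /ltW]; exact: kE.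
transitivity (\int[mu]_(x in `]0, 1[) (W x * derive1 phi x)).
  transitivity (\int[leb R]_(x in `]0, 1[) (W x * derive1 phi x)).
    by apply: eq_Rintegral => x; rewrite inE => xI; congr (_ * _); exact: VE.
  rewrite /Rintegral leb_integral_borel//; apply/measurable_EFinP.
  by apply: measurable_funM => //; exact: measurable_funTS.
transitivity (- \int[mu]_(x in `]0, 1[) (k' x * phi x)); last first.
  congr (- _); transitivity (\int[leb R]_(x in `]0, 1[) (k' x * phi x)).
    rewrite /Rintegral leb_integral_borel//; apply/measurable_EFinP.
    by apply: measurable_funM; exact: measurable_funTS.
  apply: ae_eq_leb_Rintegral.
  - exact: m01L.
  - have mk'L := borel_leb_measurable_fun measurableT (measurable_funM mk' mphi).
    exact: measurable_funS mk'L.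
  - apply: measurable_funM.
      by apply/measurable_EFinP; exact: measurable_int iv.
    have mphiL := borel_leb_measurable_fun measurableT mphi.
    exact: measurable_funS mphiL.
  - by apply: leb_aeS vk' => x vx x01; rewrite vx.
pose p := derive1 phi \_ `]0, 1[; pose q := k' \_ `]0, 1[.
have ip : mu.-integrable setT (EFin \o p).
  rewrite /p -restrict_EFin; apply/integrable_restrict => //; rewrite setTI.
  exact: (within_continuous_integrable (within_continuousT cphi) m01
    (@subset_itv_oo_cc _ _ _ _)).
have iq : mu.-integrable setT (EFin \o q).
  rewrite /q -restrict_EFin; apply/integrable_restrict => //; rewrite setTI.
  exact: integrableS ik'.
transitivity (\int[mu]_x (p x * \int[mu]_(y in `]-oo, x[) q y)).
  rewrite Rintegral_mkcond; apply: eq_Rintegral => x _.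
  rewrite /p !patchE; case: ifPn => [|_]; last by rewrite mul0r.
  rewrite inE/= => x01; rewrite mulrC; congr (_ * _).
  move: x01; rewrite in_itv/= => /andP[x0 x1].
  rewrite /q -Rintegral_mkcondr /W /parameterized_integral.
  rewrite -Rintegral_itv_obnd_cbnd; last by apply: integrableS ik'.
  rewrite -Rintegral_itv_bndo_bndc; last by apply: integrableS ik'.
  congr Rintegral.
  apply/seteqP; split=> y /=; rewrite !in_itv/=; first by move=> /andP[-> yx];
    split=> //; exact: lt_trans x1.
  by move=> [-> /andP[->]].
rewrite triangle_fubini//.
have ikphi : mu.-integrable `]0, 1[ (EFin \o (fun x => k' x * phi x)).
  apply: (@integrableM_continuous _ _ 0 1) => //; first exact: subset_itv_oo_cc.
  exact: integrableS ik'.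
rewrite -mulN1r -RintegralZl// [RHS]Rintegral_mkcond.
apply: eq_Rintegral => y _.
rewrite /q !patchE; case: ifPn => [|_]; last by rewrite mul0r.
rewrite inE/= => y01; rewrite mulN1r -mulrN; congr (_ * _).
move: y01; rewrite in_itv/= => /andP[y0 y1].
rewrite /p -Rintegral_mkcondr -C1c01_integral_derive//; congr Rintegral.
apply/seteqP; split=> x /=; rewrite !in_itv/= andbT; first by move=> [-> /andP[]].
by move=> /andP[yx ->]; split=> //; rewrite (lt_trans y0).
Qed.
(** If [h y < h x], test with the function whose derivative is a narrow tent at
    [x] minus a narrow tent at [y]. Subtracting from [h] a constant [c] between
    the two values does not change the integral, and makes the integrand
    nonnegative, and positive near [x]. *)
Lemma du_bois_reymond (h : R -> R) : {within `[0, 1], continuous h} ->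
  (forall phi, C1c01 phi ->
    \int[mu]_(x in `]0, 1[) (h x * derive1 phi x) = 0) ->
  forall x y : R, x \in `]0, 1[ -> y \in `]0, 1[ -> h x = h y.
Proof.
move=> ch h0; suff H (x y : R) : x \in `]0, 1[ -> y \in `]0, 1[ -> h x <= h y.
  by move=> x y x01 y01; apply/eqP; rewrite eq_le !H.
move=> x01 y01; rewrite leNgt; apply/negP => hyx.
pose c := (h x + h y) / 2.
have chx z : z \in `]0, 1[ -> {for z, continuous h}.
  move=> z01; have : {in `]0, 1[, continuous h}.
    by have /continuous_within_itvP[] := ch.
  by apply.
have nx : \near x, (x \in `]0, 1[) && (c < h x).
  near=> z; apply/andP; split; near: z; first exact: near_in_itvoo.
  by apply: (cvgr_gt (h x)); [exact: chx|rewrite /c; lra].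
have ny : \near y, (y \in `]0, 1[) && (h y < c).
  near=> z; apply/andP; split; near: z; first exact: near_in_itvoo.
  by apply: (cvgr_lt (h y)); [exact: chx|rewrite /c; lra].
have [d [d0 dx dy]] : exists d : R, [/\ 0 < d,
    forall z, `|z - x| <= d -> (0 < z < 1) && (c < h z) &
    forall z, `|z - y| <= d -> (0 < z < 1) && (h z < c)].
  move: nx => /nbhs_ballP[e1 /= e10 B1]; move: ny => /nbhs_ballP[e2 /= e20 B2].
  exists (Num.min e1 e2 / 2); split.
  - by rewrite divr_gt0// lt_min e10.
  - move=> z zx; have := B1 z; rewrite /ball/= in_itv/=; apply.
    rewrite distrC (le_lt_trans zx)// ltr_pdivrMr//.
    by rewrite (@le_lt_trans _ _ e1)// ?ge_min ?lexx// ltr_pMr// ltrDl.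
  - move=> z zy; have := B2 z; rewrite /ball/= in_itv/=; apply.
    rewrite distrC (le_lt_trans zy)// ltr_pdivrMr//.
    by rewrite (@le_lt_trans _ _ e2)// ?ge_min ?lexx ?orbT// ltr_pMr// ltrDl.
have [/andP[/andP[dx0 _] _] /andP[/andP[_ x1d] _]] :
  ((0 < x - d < 1) && (c < h (x - d))) /\ ((0 < x + d < 1) && (c < h (x + d))).
  by split; apply: dx; rewrite addrAC subrr add0r ?normrN gtr0_norm.
have [/andP[/andP[dy0 _] _] /andP[/andP[_ y1d] _]] :
  ((0 < y - d < 1) && (h (y - d) < c)) /\ ((0 < y + d < 1) && (h (y + d) < c)).
  by split; apply: dy; rewrite addrAC subrr add0r ?normrN gtr0_norm.
have Cb : C1c01 (tent_bump d x y) by apply: tent_bump_C1c01 => //; lra.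
have cb : continuous (derive1 (tent_bump d x y)) by case: Cb.
have m01 : measurable (`]0, 1[%classic : set (measurableTypeR R)).
  exact: measurable_itv.
have ih : mu.-integrable `]0, 1[ (EFin \o (fun z : R =>
  h z * derive1 (tent_bump d x y) z)).
  have s01 : (`]0, 1[%classic : set R) `<=` `[0, 1] by exact: subset_itv_oo_cc.
  have ih := within_continuous_integrable ch m01 s01.
  have := integrableM_continuous m01 s01 ih cb.
  exact.
have ib : mu.-integrable `]0, 1[ (EFin \o (derive1 (tent_bump d x y))).
  exact: (within_continuous_integrable (within_continuousT cb) m01
    (@subset_itv_oo_cc _ _ _ _)).
pose F (z : R) := (h z - c) * derive1 (tent_bump d x y) z.
(* The two tents have disjoint supports, as [h] is above [c] on one and below on
   the other. *)
have Fx z : `|z - x| <= d -> F z = (h z - c) * tent d (z - x).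
  move=> zx; rewrite /F derive1_tent_bump [tent d (z - y)]tent_eq0 ?subr0//.
    exact: ltW.
  rewrite leNgt; apply/negP => /ltW /dy /andP[_]; apply/negP; rewrite -leNgt ltW//.
  by have /andP[] := dx _ zx.
have F0 z : z \in `]0, 1[ -> 0 <= F z.
  move=> z01; have [zx|zx] := leP `|z - x| d.
    have /andP[_ cz] := dx _ zx.
    by rewrite Fx// mulr_ge0 ?subr_ge0 ?tent_ge0 ?(ltW cz) ?(ltW d0).
  rewrite /F derive1_tent_bump (tent_eq0 (ltW d0) (ltW zx)) sub0r.
  have [zy|zy] := leP `|z - y| d; last by rewrite (tent_eq0 (ltW d0)
    (ltW zy)) oppr0 mulr0.
  have /andP[_ cz] := dy _ zy.
  by rewrite mulrN -mulNr mulr_ge0 ?opprB ?subr_ge0 ?tent_ge0 ?(ltW cz) ?(ltW d0).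
have iF : mu.-integrable `]0, 1[ (EFin \o F).
  have := @integrableB _ (measurableTypeR R) R mu _ m01 _ _ ih
    (@integrableZl _ (measurableTypeR R) R mu _ m01 c _ ib).
  by apply: eq_integrable => // z _ /=; rewrite /F mulrBl.
have intF : \int[mu]_(z in `]0, 1[) F z = 0.
  transitivity (\int[mu]_(z in `]0, 1[) (h z * derive1 (tent_bump d x y) z) -
      \int[mu]_(z in `]0, 1[) (c * derive1 (tent_bump d x y) z)).
    rewrite -RintegralB//; first by apply: eq_Rintegral => z _; rewrite /F mulrBl.
    have := @integrableZl _ (measurableTypeR R) R mu _ m01 c _ ib.
    by apply: eq_integrable => // z _.
  rewrite h0// RintegralZl// C1c01_integral_derive//.
  have [_ _ [a [b [a0 _ ->]]]] := Cb; first by rewrite oppr0 mulr0 subr0.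
  by rewrite in_itv/= negb_and -ltNge a0.
have : {ae leb R, forall z, z \in `]0, 1[ -> F z = 0}.
  apply: ae_lebesgue_leb.
  have /(ae_eq_integral_abs mu m01 (measurable_int mu iF)) :
      (\int[mu]_(z in `]0%R, 1%R[) `|(EFin \o F) z| = 0)%E.
    transitivity (\int[mu]_(z in `]0%R, 1%R[) (F z)%:E)%E; last first.
      have iFf := integrable_fin_num m01 iF.
      by rewrite -(fineK iFf); move: intF; rewrite /Rintegral => ->.
    by apply: eq_integral => z; rewrite inE => z01 /=; rewrite ger0_norm// F0.
  move=> [N [mN N0 sN]]; exists N; split => // z /= Fz; apply: sN => /= H.
  by apply: Fz => z01; have := H z01; move=> [].
move=> F00; have xdd : x - d < x + d by rewrite ltrBlDr -addrA ltrDl addr_gt0.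
have [|z] := @ae_exists_oo _ (fun z => z \in `]0, 1[ -> F z = 0) _ _ xdd.
  by apply: leb_aeS F00 => z zF _.
rewrite in_itv/= => /andP[xz zx].
have zxd : `|z - x| < d by rewrite ltr_norml; apply/andP; split; lra.
have [/andP[z01 cz]] : (0 < z < 1) && (c < h z) by apply: dx; exact: ltW.
rewrite in_itv/= => /(_ z01) /eqP; rewrite Fx ?ltW// mulf_eq0 => /orP[].
  by rewrite subr_eq0 gt_eqF.
by rewrite gt_eqF// tent_gt0.
Unshelve. all: by end_near. Qed.

(** The difference between [w] and the primitive of [v] has zero weak derivative,
    so it is constant; it vanishes at [0]. *)
Lemma primitive_of_weak_derivative (u v : LT -> R) (w : R -> R) :
  measurable_fun (`]0, 1[%classic : set LT) u -> (leb R).-integrable `]0,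
    1[ (EFin \o v) ->
  weak_derivative01 u v -> {within `[0, 1], continuous w} ->
  {ae leb R, forall x, x \in `]0, 1[ -> u x = w x} -> w 0 = 0 ->
  forall x : R, x \in `[0, 1] -> w x = \int[leb R]_(y in `]0, x[) v y.
Proof.
move=> mu_ iv uv cw uw w0.
have m01 : measurable (`]0, 1[%classic : set (measurableTypeR R)).
  exact: measurable_itv.
have m01L : measurable (`]0, 1[%classic : set LT) by exact: borel_leb_measurable.
have s01 : (`]0, 1[%classic : set R) `<=` `[0, 1] by exact: subset_itv_oo_cc.
pose V (x : R) := \int[leb R]_(y in `]0, x[) v y.
have cV : {within `[0, 1], continuous V} by exact: primitive_continuous.
have ch : {within `[0, 1], continuous (fun x => w x - V x)}.
  by move=> x; apply: cvgB; [exact: cw|exact: cV].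
have hE : forall phi, C1c01 phi ->
    \int[mu]_(x in `]0, 1[) ((w x - V x) * derive1 phi x) = 0.
  move=> phi Cphi; have cphi : continuous (derive1 phi) by case: Cphi.
  have mphi' : measurable_fun setT (derive1 phi) by exact: continuous_measurable_fun.
  have iC (f : R -> R) : {within `[0, 1], continuous f} ->
      mu.-integrable `]0, 1[ (EFin \o (fun x => f x * derive1 phi x)).
    move=> cf; have If := within_continuous_integrable cf m01 s01.
    exact: integrableM_continuous m01 s01 If cphi.
  have intC (f : R -> R) : {within `[0, 1], continuous f} ->
      \int[leb R]_(x in `]0, 1[) (f x * derive1 phi x) =
      \int[mu]_(x in `]0, 1[) (f x * derive1 phi x).
    move=> cf; rewrite /Rintegral (leb_integral_borel m01)//.
    exact: (measurable_int mu (iC f cf)).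
  transitivity (\int[mu]_(x in `]0, 1[) (w x * derive1 phi x) -
      \int[mu]_(x in `]0, 1[) (V x * derive1 phi x)).
    rewrite -(RintegralB m01 (iC _ cw) (iC _ cV)).
    by apply: eq_Rintegral => x _; rewrite mulrBl.
  rewrite -!intC//; apply/eqP; rewrite subr_eq0; apply/eqP.
  transitivity (\int[leb R]_(x in `]0, 1[) (u x * derive1 phi x)).
    apply: ae_eq_leb_Rintegral.
    - exact: m01L.
    - have := measurable_int mu (iC w cw) => /measurable_EFinP.
      exact: borel_leb_measurable_fun.
    - apply: measurable_funM; first exact: mu_.
      have mphiL := borel_leb_measurable_fun measurableT mphi'.
      exact: measurable_funS mphiL.
    - by apply: leb_aeS uw => x ux x01; rewrite ux.
  by rewrite (uv _ Cphi) -(weak_derivative_primitive iv Cphi).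
have half01 : (2^-1 : R) \in `]0, 1[ by rewrite in_itv/=; apply/andP; split; lra.
have hc : forall x : R, x \in `[0, 1] -> w x - V x = w 2^-1 - V 2^-1.
  apply: (@continuous_ae_eq _ (fun x => w x - V x) (cst (w 2^-1 - V 2^-1))) => //.
    by apply: within_continuousT; exact: cst_continuous.
  by apply: aeW => x x01; exact: (du_bois_reymond ch hE).
have V0 : V 0 = 0 by rewrite /V set_itv_ge ?Rintegral_set0// bnd_simp ltxx.
move=> x x01; rewrite -/(V x).
have := hc _ x01; rewrite -(hc 0) ?in_itv/= ?lexx ?ler01// w0 V0 subrr => /eqP.
by rewrite subr_eq0 => /eqP.
Qed.

End du_bois_reymond.

(** * Finiteness of the Lebesgue norms *)
Section Lp.
Context {R : realType}.
Local Notation LT := (lebesgueTypeR R).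
Implicit Types (D E : set LT) (f g h : LT -> R) (p : \bar R).

(** The finiteness of the norm is all that matters in the definition of the
    function spaces. This lemma and [Lnormy_ltyP] reduce it, for finite and
    infinite exponents, to a finite integral and to an essential bound. *)
Lemma Lnorm_ltyP (r : R) f : 0 < r ->
  ('N[leb R]_(r%:E)[EFin \o f] < +oo <->
   \int[leb R]_x (`|f x| `^ r)%:E < +oo)%E.
Proof.
move=> r0; rewrite unlock /Lnorm.
have -> : (\int[leb R]_x (`|(EFin \o f) x| `^ r) = \int[leb R]_x (`|f x| `^ r)%:E)%E.
  by apply: eq_integral => x _.
split=> [|foo]; last exact: poweR_lty.
by apply: lty_poweRy; rewrite invr_eq0 gt_eqF.
Qed.

Lemma leb_setT_gt0 : (0 < leb R setT)%E.
Proof.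
apply: (@lt_le_trans _ _ (leb R `]0%R, 1%R[)); first exact: leb_oo_gt0.
by apply: le_outer_measure.
Qed.

Lemma Lnormy_ltyP f : ('N[leb R]_(+oo)[EFin \o f] < +oo)%E <->
   exists M, {ae leb R, forall x, `|f x| <= M}.
Proof.
rewrite unlock /Lnorm leb_setT_gt0; split => [|[M fM]].
  by move=> /(@ess_supr_bounded _ _ _ (leb R) (fun x => `|f x|))[M MP]; exists M.
apply: (@le_lt_trans _ _ M%:E); last exact: ltry.
by apply/ess_supP; apply: leb_aeS fM => x fx /=; rewrite lee_fin.
Qed.

Lemma lebesgue_measurable_restrict D f : measurable D ->
  lebesgue_measurable_fun D f <-> measurable_fun setT (f \_ D : LT -> R).
Proof.
move=> mD; rewrite /lebesgue_measurable_fun.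
by have := @measurable_restrictT _ _ LT R D f mD.
Qed.

Lemma measurable_normr_powR (f : LT -> R) (r : R) :
  measurable_fun setT f -> measurable_fun setT (fun x : LT => (`|f x| `^ r)%:E).
Proof.
move=> mf; apply/measurable_EFinP.
apply: (@measurableT_comp _ _ _ _ _ _ (@powR R ^~ r)); first exact: measurable_powR.
exact: measurableT_comp mf.
Qed.

Lemma powR_le_sum (r a s t : R) : 0 <= r -> 0 <= a -> 0 <= s -> 0 <= t ->
  (a * (s + t)) `^ r <= (2 * a) `^ r * (s `^ r + t `^ r).
Proof.
move=> r0 a0 s0 t0.
have [st|ts] := leP s t.
  apply: (@le_trans _ _ ((2 * a * t) `^ r)).
    apply: ge0_ler_powR => //; rewrite ?nnegrE ?mulr_ge0 ?addr_ge0//.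
    by rewrite (_ : 2 * a * t = a * (t + t)) ?ler_wpM2l ?lerD2r//; ring.
  by rewrite powRM ?mulr_ge0// ler_wpM2l ?powR_ge0// lerDr powR_ge0.
apply: (@le_trans _ _ ((2 * a * s) `^ r)).
  apply: ge0_ler_powR => //; rewrite ?nnegrE ?mulr_ge0 ?addr_ge0//.
  by rewrite (_ : 2 * a * s = a * (s + s)) ?ler_wpM2l ?lerD2l ?(ltW ts)//; ring.
by rewrite powRM ?mulr_ge0// ler_wpM2l ?powR_ge0// lerDl powR_ge0.
Qed.

(** A single domination rule replaces the triangle inequality, homogeneity and
    monotonicity of the norm. *)
Lemma Lnorm_dominated p (f g h : LT -> R) (a : R) : (1 <= p)%E -> 0 <= a ->
  measurable_fun setT f -> measurable_fun setT g -> measurable_fun setT h ->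
  {ae leb R, forall x, `|h x| <= a * (`|f x| + `|g x|)} ->
  ('N[leb R]_p[EFin \o f] < +oo)%E -> ('N[leb R]_p[EFin \o g] < +oo)%E ->
  ('N[leb R]_p[EFin \o h] < +oo)%E.
Proof.
case: p => [r| |//]; last first.
  move=> _ a0 mf mg mh hfg /Lnormy_ltyP[M fM] /Lnormy_ltyP[N gN].
  apply/Lnormy_ltyP; exists (a * (M + N)).
  apply: leb_aeS (leb_aeI hfg (leb_aeI fM gN)) => x [hx [fx gx]].
  by apply: le_trans hx _; rewrite ler_wpM2l// lerD.
rewrite lee_fin => r1 a0 mf mg mh hfg.
have r0 : 0 < r by apply: lt_le_trans r1.
move=> /(Lnorm_ltyP _ r0) foo /(Lnorm_ltyP _ r0) goo; apply/(Lnorm_ltyP _ r0).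
have mfr := measurable_normr_powR r mf; have mgr := measurable_normr_powR r mg.
have mhr := measurable_normr_powR r mh.
pose C := ((2 * a) `^ r)%:E.
have C0 : (0 <= C)%E by rewrite lee_fin powR_ge0.
apply: (@le_lt_trans _ _ (\int[leb R]_x (C * ((`|f x| `^ r)%:E + (`|g x| `^ r)%:E)))%E).
  apply: (@ae_ge0_le_integral _ _ _ (leb R) setT measurableT _ _ _ mhr).
  - by move=> x _; rewrite lee_fin powR_ge0.
  - by move=> x _; rewrite -EFinD -EFinM lee_fin mulr_ge0 ?addr_ge0 ?powR_ge0.
  - exact: emeasurable_funM (measurable_cst _) (emeasurable_funD mfr mgr).
  - apply: leb_aeS hfg => x hx _; rewrite -EFinD -EFinM lee_fin.
    apply: le_trans (powR_le_sum (ltW r0) a0 (normr_ge0 _) (normr_ge0 _)).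
    apply: ge0_ler_powR => //; first exact: ltW.
    by rewrite nnegrE mulr_ge0// addr_ge0.
have pow0 (k : LT -> R) x :
  setT x -> (0 <= (`|k x| `^ r)%:E)%E by rewrite lee_fin powR_ge0.
rewrite (@ge0_integralZl _ _ _ (leb R) setT measurableT _ (emeasurable_funD mfr mgr) C _ C0).
  rewrite (@ge0_integralD _ _ _ (leb R) setT measurableT _ _ (@pow0 f) mfr (@pow0 g) mgr).
  exact: (lte_mul_pinfty C0 _ (lte_add_pinfty foo goo)).
by move=> x _; rewrite -EFinD lee_fin addr_ge0 ?powR_ge0.
Qed.

End Lp.

(** * Functions of class Lp on a set *)
Section in_Lp_theory.
Context {R : realType}.
Local Notation LT := (lebesgueTypeR R).
Implicit Types (D E : set LT) (f g h : LT -> R) (p : \bar R).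

(** The functions [f] and [g] are extended by zero outside their own domains, so
    that the rule covers unions of domains, and constants as dominating
    functions on a set of finite measure. *)
Lemma in_Lp_dominated p D D' E f g h (a : R) : (1 <= p)%E -> 0 <= a ->
  measurable D -> measurable D' -> measurable E ->
  lebesgue_measurable_fun E h ->
  {ae leb R, forall x, E x -> `|h x| <= a * (`|(f \_ D) x| + `|(g \_ D') x|)} ->
  in_Lp p D f -> in_Lp p D' g -> in_Lp p E h.
Proof.
move=> p1 a0 mD mD' mE mh hfg [mf foo] [mg goo]; split; first exact: mh.
have mf' := (lebesgue_measurable_restrict f mD).1 mf.
have mg' := (lebesgue_measurable_restrict g mD').1 mg.
have mh' := (lebesgue_measurable_restrict h mE).1 mh.
apply: (Lnorm_dominated p1 a0 mf' mg' mh' _ foo goo).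
apply: leb_aeS hfg => x hx; rewrite [X in `|X|]patchE.
case: ifPn => [|_]; first by rewrite inE; exact: hx.
by rewrite normr0 mulr_ge0// addr_ge0.
Qed.

Lemma in_Lp_ae p D E f g : (1 <= p)%E -> measurable D -> measurable E ->
  {ae leb R, forall x, E x -> D x /\ f x = g x} -> in_Lp p D f -> in_Lp p E g.
Proof.
move=> p1 mD mE fg fLp.
have mg : lebesgue_measurable_fun E g.
  exact: (leb_measurable_fun_ae mD mE fg fLp.1).
apply: (in_Lp_dominated p1 ler01 mD mD mE mg _ fLp fLp).
apply: leb_aeS fg => x fg Ex; have [Dx fgx] := fg Ex.
by rewrite mul1r patchE mem_set// fgx lerDl.
Qed.

Lemma in_LpS p D E f : (1 <= p)%E -> measurable D -> measurable E -> E `<=` D ->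
  in_Lp p D f -> in_Lp p E f.
Proof.
by move=> p1 mD mE ED; apply: in_Lp_ae => //; apply: aeW => x /ED.
Qed.

Lemma in_Lp_setU p D E f : (1 <= p)%E -> measurable D -> measurable E ->
  in_Lp p D f -> in_Lp p E f -> in_Lp p (D `|` E) f.
Proof.
move=> p1 mD mE fD fE; have mDE := measurableU _ _ mD mE.
have mf : lebesgue_measurable_fun (D `|` E) f.
  by apply/(@measurable_funU _ _ LT R D E f mD mE); split; [exact: fD.1|exact: fE.1].
apply: (in_Lp_dominated p1 ler01 mD mE mDE mf _ fD fE).
apply: aeW => x DEx; rewrite mul1r !patchE.
by case: DEx => xX; rewrite (mem_set xX); [rewrite lerDl|rewrite lerDr].
Qed.

Lemma in_Lp_cst p D (c : R) : (1 <= p)%E -> measurable D -> (leb R D < +oo)%E ->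
  in_Lp p D (cst c).
Proof.
move=> p1 mD Doo; split; first exact: measurable_cst.
case: p p1 => [r| |//].
- rewrite lee_fin => r1; have r0 : 0 < r by exact: lt_le_trans r1.
  apply/(Lnorm_ltyP _ r0).
  rewrite (_ : (fun x : LT => _) = (fun x => (`|c| `^ r)%:E) \_ D).
    rewrite -integral_mkcond integral_cst//.
    by rewrite lte_mul_pinfty// lee_fin powR_ge0.
  apply/funext => x; rewrite /= !patchE; case: ifP => // _.
  by rewrite normr0 powR0// gt_eqF.
- move=> _; apply/Lnormy_ltyP; exists `|c|; apply: aeW => x.
  by rewrite patchE; case: ifP => // _; rewrite normr0.
Qed.

Lemma in_Lp_lincomb p D f g (a b : R) : (1 <= p)%E -> measurable D ->
  in_Lp p D f -> in_Lp p D g -> in_Lp p D (fun x => a * f x + b * g x).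
Proof.
move=> p1 mD fD gD.
have mh : lebesgue_measurable_fun D (fun x => a * f x + b * g x).
  apply: measurable_funD.
    exact: measurable_funM (measurable_cst _) fD.1.
  exact: measurable_funM (measurable_cst _) gD.1.
have ab0 : 0 <= `|a| + `|b| by rewrite addr_ge0.
apply: (in_Lp_dominated p1 ab0 mD mD mD mh _ fD gD).
apply: aeW => x Dx; rewrite !patchE mem_set//.
rewrite (le_trans (ler_normD _ _))// !normrM mulrDr.
by rewrite lerD// ler_wpM2r// ?lerDl ?lerDr.
Qed.

Lemma in_Lp_comp T p D f : (1 <= p)%E -> leb_preserving T -> measurable D ->
  in_Lp p D f -> in_Lp p (T @^-1` D) (f \o T).
Proof.
move=> p1 TP mD [mf foo]; have mT := leb_preserving_measurable TP.
have mf' := (lebesgue_measurable_restrict f mD).1 mf.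
have mTD : measurable (T @^-1` D : set LT).
  by rewrite -[X in measurable X]setTI; exact: mT.
have fTE : (f \o T) \_ (T @^-1` D) = (f \_ D) \o T.
  by apply/funext => x; rewrite /= !patchE.
split.
  apply/(lebesgue_measurable_restrict _ mTD); rewrite fTE.
  exact: measurableT_comp mf' mT.
rewrite fTE; case: p p1 foo => [r| |//].
- rewrite lee_fin => r1; have r0 : 0 < r by exact: lt_le_trans r1.
  move=> /(Lnorm_ltyP _ r0) foo; apply/(Lnorm_ltyP _ r0).
  have pow0 (x : LT) : setT x -> (0 <= (`|(f \_ D) x| `^ r)%:E)%E.
    by rewrite lee_fin powR_ge0.
  by have /= -> := leb_ge0_integral_comp TP measurableT
    (measurable_normr_powR r mf') pow0.
- move=> _ /Lnormy_ltyP[M fM]; apply/Lnormy_ltyP; exists M.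
  exact: (leb_preserving_ae TP fM).
Qed.

(** For a finite exponent [r], [|f| <= 1 + |f| ^ r]. *)
Lemma in_Lp_integrable p D f : (1 <= p)%E -> measurable D -> (leb R D < +oo)%E ->
  in_Lp p D f -> (leb R).-integrable D (EFin \o f).
Proof.
move=> p1 mD Doo fD; have mf := fD.1.
have mf' := (lebesgue_measurable_restrict f mD).1 mf.
suff foo : (\int[leb R]_(x in D) `|f x|%:E < +oo)%E.
  by apply/integrableP; split; [exact/measurable_EFinP|exact: foo].
have mfE : measurable_fun D (fun x => `|f x|%:E).
  by apply/measurable_EFinP; exact: measurableT_comp mf.
case: p p1 fD => [r| |//].
- rewrite lee_fin => r1 [_]; have r0 : 0 < r by exact: lt_le_trans r1.
  move=> /(Lnorm_ltyP _ r0) foo.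
  have mfr := measurable_normr_powR r mf'.
  have mfrD : measurable_fun D (fun x => (`|(f \_ D) x| `^ r)%:E).
    exact: measurable_funS mfr.
  have pow0 (x : LT) : (0 <= (`|(f \_ D) x| `^ r)%:E)%E by rewrite lee_fin powR_ge0.
  apply: (@le_lt_trans _ _ (\int[leb R]_(x in D) (1%:E + (`|(f \_ D) x| `^ r)%:E))%E).
    have mD1 := emeasurable_funD (measurable_cst (1%:E : \bar R)) mfrD.
    apply: (@ge0_le_integral _ _ _ (leb R) D mD _ _ _ mfE mD1).
    - by [].
    - move=> x Dx; rewrite -EFinD lee_fin patchE mem_set//.
      have [fx1|/ltW fx1] := leP `|f x| 1.
        by rewrite (le_trans fx1)// lerDl powR_ge0.
      rewrite (@le_trans _ _ (`|f x| `^ r))// ?lerDr//.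
      by rewrite -[leLHS]powRr1// ler_powR.
  rewrite (@ge0_integralD _ _ _ (leb R) D mD (cst 1%:E) _ (fun _ _ => @lee01 R)
    (measurable_cst _) (fun x _ => pow0 x) mfrD).
  rewrite integral_cst// mul1e lte_add_pinfty//.
  apply: le_lt_trans foo.
  exact: (@ge0_subset_integral _ _ _ (leb R) D setT mD measurableT _ mfr (fun x _ => pow0 x) (@subsetT _ _)).
- move=> _ [_ /Lnormy_ltyP[M fM]].
  apply: (@le_lt_trans _ _ (\int[leb R]_(x in D) `|M|%:E)%E).
    apply: (@ae_ge0_le_integral _ _ _ (leb R) D mD _ _ _ mfE).
    + by [].
    + by [].
    + exact: measurable_cst.
    + apply: leb_aeS fM => x fx Dx; rewrite lee_fin (le_trans _ (ler_norm _))//.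
      by move: fx; rewrite patchE mem_set.
  by rewrite integral_cst// lte_mul_pinfty.
Qed.

End in_Lp_theory.

(** * Superposition operators *)
Section superposition.
Context {R : realType}.
Local Notation LT := (lebesgueTypeR R).
Implicit Types (D : set LT) (p : \bar R) (phi : R -> R).

(** Universal measurability is applied to the normalized image of the Lebesgue
    measure on [D] under [g]: it encloses [phi @^-1` Y] between Borel sets whose
    preimages under [g] differ by a null set, and the Lebesgue measure is
    complete. *)
Lemma universally_measurable_comp phi D (g : LT -> R) :
  universally_measurable_fun phi -> measurable D ->
  (0 < leb R D)%E -> (leb R D < +oo)%E ->
  lebesgue_measurable_fun D g -> lebesgue_measurable_fun D (phi \o g).
Proof.
move=> phiU mD D0 Doo mg _ Y mY.
have mG := (lebesgue_measurable_restrict g mD).1 mg.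
pose G : LT -> measurableTypeR R := g \_ D.
have mG' : measurable_fun setT G by exact: mG.
pose nu : probability (measurableTypeR R) R :=
  mnormalize (pushforward (mrestr (leb R) mD) G) (dirac (0 : measurableTypeR R)).
have [A [B [mA mB AM MB nuBA]]] := phiU Y mY (nu mG').
have nBA : leb R (G @^-1` (B `\` A) `&` D) = 0%E.
  move: nuBA; rewrite /nu /= /mnormalize /= /pushforward /mrestr preimage_setT setTI.
  rewrite (gt_eqF D0) (lt_eqF Doo) /= => /eqP; rewrite mule_eq0 => /orP[/eqP //|].
  rewrite eqe invr_eq0 fine_eq0 ?(gt_eqF D0)//.
  by rewrite ge0_fin_numE.
have mGA (C : set (measurableTypeR R)) :
  measurable C -> measurable (G @^-1` C : set LT).
  by move=> mC; rewrite -[X in measurable X]setTI; exact (mG' measurableT _ mC).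
have GE (x : LT) : D x -> G x = g x by move=> Dx; rewrite /G patchE mem_set.
rewrite (_ : D `&` _ = (D `&` G @^-1` A) `|`
    (D `&` G @^-1` ((phi @^-1` Y) `\` A))).
  apply: measurableU; first exact: measurableI (mGA _ mA).
  apply: leb_negligible_measurable; exists (G @^-1` (B `\` A) `&` D); split => //.
    by apply: measurableI => //; apply: mGA; exact: measurableD.
  by move=> x [Dx [/MB Bx Ax]].
apply/seteqP; split=> [x [Dx Yx]|x].
  have [Ax|Ax] := pselect (A (G x)); first by left.
  by right; do 2 split => //; rewrite /preimage/= GE.
move=> [[Dx /AM]|[Dx [+ _]]]; rewrite /preimage /= GE//.
Qed.

Lemma in_Lp_linear_growth p phi D (f : LT -> R) : (1 <= p)%E ->
  universally_measurable_fun phi -> linear_growth phi ->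
  measurable D -> (0 < leb R D)%E -> (leb R D < +oo)%E ->
  in_Lp p D f -> in_Lp p D (phi \o f).
Proof.
move=> p1 phiU [a [b [a0 b0 phiab]]] mD D0 Doo fD.
have mphif := universally_measurable_comp phiU mD D0 Doo fD.1.
have ab0 : 0 <= a + b by rewrite addr_ge0.
apply: (in_Lp_dominated p1 ab0 mD mD mD mphif _ fD (in_Lp_cst 1 p1 mD Doo)).
apply: aeW => x Dx; rewrite !patchE mem_set// normr1 (le_trans (phiab _))//.
by rewrite mulrDr mulr1 lerD// ?ler_wpM2r// ?lerDl ?lerDr.
Qed.

Lemma in_Loo_bounded_to_bounded phi D (f : LT -> R) :
  universally_measurable_fun phi -> bounded_to_bounded phi ->
  measurable D -> (0 < leb R D)%E -> (leb R D < +oo)%E ->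
  in_Lp +oo%E D f -> in_Lp +oo%E D (phi \o f).
Proof.
move=> phiU phiB mD D0 Doo fD.
have mphif := universally_measurable_comp phiU mD D0 Doo fD.1.
split; first exact: mphif.
move: fD => [_ /Lnormy_ltyP[M fM]]; apply/Lnormy_ltyP.
have : bounded_set [set y : R | `|y| <= M].
  by exists M; split; [exact: num_real|move=> N MN y /= yM; rewrite (le_trans yM) ?ltW].
move=> /phiB [N [_ NP]]; exists (Num.max 0 (N + 1)).
apply: leb_aeS fM => x; rewrite !patchE; case: ifPn => [_ fx|_ _]; last first.
  by rewrite normr0 le_max lexx.
rewrite le_max; apply/orP; right; apply: (NP (N + 1)); first by rewrite ltrDl.
by exists (f x).
Qed.

End superposition.

(** * The delay equation carried by the wave equation *)
Section wave_data.
Context {R : realType}.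
Local Notation LT := (lebesgueTypeR R).
Implicit Types (f g : LT -> R).

Lemma sqrt2_neq0 : Num.sqrt 2 != 0 :> R.
Proof. by rewrite gt_eqF// sqrtr_gt0. Qed.

Lemma sqr_sqrt2 : Num.sqrt 2 ^+ 2 = 2 :> R.
Proof. by rewrite sqr_sqrtr. Qed.

(** In the rotated coordinates the boundary condition relates the wave [g (t - 1)]
    reaching the boundary to the reflected wave, in the form [- f (t + 1)]. Since
    the Dirichlet condition gives [f = - g] on the half-line, it is a relation between [g (t - 1)] and
    [g (t + 1)]. *)
Lemma rotation_dalembert (f g : R -> R) (t : R) :
  rotation (dalembert_t f g t 1, - dalembert_x f g t 1) = (g (t - 1), - f (t + 1)).
Proof.
rewrite /rotation /dalembert_t /dalembert_x /=.
have s0 := sqrt2_neq0; have s2 := sqr_sqrt2.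
by congr (_, _); field: s2.
Qed.

Lemma rotation_inj : injective (@rotation R).
Proof.
move=> [a b] [c d]; rewrite /rotation /= => -[e1 e2].
have s0 : (Num.sqrt 2)^-1 != 0 :> R by rewrite invr_eq0 sqrt2_neq0.
have ab : a + b = c + d by apply: (mulfI s0); rewrite !mulrDr.
have ba : - a + b = - c + d.
  by apply: (mulfI s0); rewrite !mulrDr !mulrN -!mulNr.
congr (_, _); lra.
Qed.

Lemma ae_neq (c : R) : {ae leb R, forall x, x != c}.
Proof.
exists [set c]; split.
- exact: borel_leb_measurable.
- exact: lebesgue_measure_set1.
- by move=> x /= /negP; rewrite negbK => /eqP.
Qed.

Lemma leb_itv_fin (a b : R) (b0 b1 : bool) :
  (leb R [set` Interval (BSide b0 a) (BSide b1 b)] < +oo)%E.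
Proof. by rewrite leb_itv lebesgue_measure_itv/=; case: ifP => _; rewrite ?ltry. Qed.

Lemma leb_measurable_itv (i : interval R) : measurable ([set` i] : set LT).
Proof. by apply: borel_leb_measurable; exact: measurable_itv. Qed.

Lemma leb_integrable_comp T (D : set LT) (f : LT -> R) : leb_preserving T ->
  measurable D -> (leb R).-integrable D (EFin \o f) ->
  (leb R).-integrable (T @^-1` D) (EFin \o (f \o T)).
Proof.
move=> TP mD /integrableP[mf foo]; apply/integrableP; split.
  have mT := leb_preserving_measurable TP.
  apply: (@measurable_comp _ _ _ LT LT _ D (EFin \o f) (T @^-1` D) T mD _ mf).
    by move=> _ [x Dx <-].
  exact: measurable_funTS.
have /= -> := @leb_ge0_integral_comp _ T D (fun x => `|(f x)%:E|%E) TP mD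
  (measurableT_comp (@measurable_realfun.abse_measurable R setT) mf)
  (fun x _ => abse_ge0 _).
exact: foo.
Qed.

Lemma opp_preimage_oo (a b : R) : -%R @^-1` `]a, b[ = `](- b), (- a)[%classic :> set R.
Proof. by apply/seteqP; split=> x /=; rewrite !in_itv/= ltrNr ltrNl andbC. Qed.

(** Up to the factor [sqrt 2] the left-hand side is the solution at time [0]; the
    formula shows that its derivative is [f x - g (- x)]. *)
Lemma int0_dalembert (f g : LT -> R) (x : R) : 0 <= x ->
  (leb R).-integrable `]0, x[ (EFin \o f) ->
  (leb R).-integrable `](- x), 0[ (EFin \o g) ->
  int0 f x + int0 g (- x) = \int[leb R]_(y in `]0, x[) (f y - g (- y)).
Proof.
move=> x0 iff ig; rewrite /int0 x0 oppr_ge0.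
have Nx : -%R @^-1` `](- x), 0[ = `]0, x[%classic :> set R.
  by rewrite opp_preimage_oo oppr0 opprK.
have mN := leb_measurable_itv `](- x), 0[.
have igN := leb_integrable_comp leb_preservingN mN ig.
rewrite (RintegralB (leb_measurable_itv `]0, x[) iff); last by rewrite -Nx; exact: igN.
congr (_ + _); have [x0'|_] := leP x 0.
  have -> : x = 0 by apply/eqP; rewrite eq_le x0' x0.
  by rewrite oppr0 set_itv_ge ?Rintegral_set0 ?oppr0// bnd_simp ltxx.
congr (- _); rewrite -[in RHS]Nx.
have mg : measurable_fun (`](- x), 0[%classic : set LT) g.
  by apply/measurable_EFinP; exact: measurable_int ig.
exact/esym/(leb_Rintegral_comp leb_preservingN mN mg).
Qed.

(** The method of steps: on [[2n - 1, 2n + 1)] the solution is [phi] iterated [n]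
    times on the initial function. *)
Lemma delay_extension (phi g0 : R -> R) : exists g : R -> R,
  (forall t, t \in `[(- 1), 1[ -> g t = g0 t) /\
  (forall t, - 1 <= t -> g (t + 2) = phi (g t)).
Proof.
pose n (t : R) := Num.truncn ((t + 1) / 2).
exists (fun t => iter (n t) phi (g0 (t - 2 * (n t)%:R))); split=> t.
  rewrite in_itv/= => /andP[t1 t2].
  have -> : n t = 0%N.
    by apply: Num.Theory.truncn_def; rewrite mulr1n; apply/andP; split; lra.
  by rewrite /= mulr0 subr0.
move=> t1; have -> : n (t + 2) = (n t).+1.
  have t0 : 0 <= (t + 1) / 2 by rewrite divr_ge0//; lra.
  have /andP[] := Num.Theory.truncn_itv t0; rewrite -/(n t) -(natr1 (n t)) => l u.
  by apply: Num.Theory.truncn_def; rewrite -(natr1 (n t).+1) -(natr1 (n t));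
    apply/andP; split; lra.
rewrite iterS; congr (phi (iter _ _ (g0 _))).
by rewrite -(natr1 (n t)); ring.
Qed.

End wave_data.

(** * Existence of solutions *)
Section existence.
Context {R : realType}.
Local Notation LT := (lebesgueTypeR R).

(** The two equations express [f (x) - g (- x) = sqrt 2 * v x] and
    [f (x) + g (- x) = sqrt 2 * z1 x], with [f = - g0] and [g = g0]. *)
Lemma in_Lp_initial p (v z1 : LT -> R) : (1 <= p)%E ->
  in_Lp p `]0, 1[ v -> in_Lp p `]0, 1[ z1 ->
  exists2 g0 : R -> R, in_Lp p `[(- 1), 1[ g0 &
    forall x, x \in `]0,
      1[ -> g0 x = (- (Num.sqrt 2)^-1) * v x + (- (Num.sqrt 2)^-1) * z1 x /\
      g0 (- x) = (- (Num.sqrt 2)^-1) * v x + (Num.sqrt 2)^-1 * z1 x.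
Proof.
move=> p1 vL zL; set s := (Num.sqrt 2)^-1.
pose a (x : R) := (- s) * v x + (- s) * z1 x.
pose b (x : R) := (- s) * v x + s * z1 x.
have m01 := @leb_measurable_itv R `]0, 1[.
have aL : in_Lp p `]0, 1[ a by exact: in_Lp_lincomb.
have bL : in_Lp p `]0, 1[ b by exact: in_Lp_lincomb.
have bNL : in_Lp p `](- 1), 0[ (b \o -%R).
  have := in_Lp_comp p1 leb_preservingN m01 bL.
  by rewrite opp_preimage_oo oppr0.
pose g0 (x : R) := if 0 < x then a x else b (- x).
exists g0; last first.
  move=> x; rewrite in_itv/= => /andP[x0 _]; rewrite /g0 x0 oppr_gt0 ltNge ltW//=.
  by rewrite opprK.
have mN := @leb_measurable_itv R `](- 1), 0[.
have mU := measurableU _ _ mN m01.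
have UL : in_Lp p (`](- 1), 0[ `|` `]0, 1[) g0.
  apply: (in_Lp_setU p1 mN m01).
    apply: (in_Lp_ae p1 mN mN _ bNL); apply: aeW => x x0; split => //.
    by move: x0; rewrite /g0 /= in_itv/= => /andP[_ /ltW]; rewrite leNgt => /negbTE ->.
  apply: (in_Lp_ae p1 m01 m01 _ aL); apply: aeW => x x0; split => //.
  by move: x0; rewrite /g0 /= in_itv/= => /andP[-> _].
apply: (in_Lp_ae p1 mU (leb_measurable_itv _) _ UL).
apply: leb_aeS (leb_aeI (ae_neq (- 1)) (ae_neq 0)) => x [xN1 x0].
rewrite /= in_itv/= => /andP[xl xr]; split => //.
have [x0'|x0'] := ltP 0 x; [right|left]; rewrite /= in_itv/=.
  by rewrite x0'.
by rewrite !lt_neqAle eq_sym xN1 xl x0 x0'.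
Qed.

Lemma in_Lp_delay p (phi g : R -> R) : (1 <= p)%E ->
  (forall (D : set LT) (f : LT -> R), measurable D -> (0 < leb R D)%E ->
    (leb R D < +oo)%E -> in_Lp p D f -> in_Lp p D (phi \o f)) ->
  (forall t, - 1 <= t -> g (t + 2) = phi (g t)) ->
  in_Lp p `[(- 1), 1[ g -> in_Lp_loc p (- 1) g.
Proof.
move=> p1 phiL gphi gL.
have H (n : nat) : in_Lp p `[(- 1), n.*2.+1%:R[ g.
  elim: n => [|n IH]; first by [].
  have cn : - 1 < n.*2.+1%:R :> R by rewrite (lt_le_trans (ltrN10 _))// ler0n.
  pose I : set LT := `[(- 1), (n.*2.+1%:R : R)[%classic.
  have mI : measurable I by exact: leb_measurable_itv.
  have I0 : (0 < leb R I)%E.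
    by rewrite /I leb_itv lebesgue_measure_itv/= lte_fin cn -EFinB lte_fin subr_gt0.
  have T2 := @leb_preservingD R (- 2).
  have phigL := in_Lp_comp p1 T2 mI (phiL I g mI I0 (leb_itv_fin _ _ _ _) IH).
  have mTI : measurable (+%R (- 2 : R) @^-1` I : set LT).
    by rewrite -[X in measurable X]setTI; exact: (leb_preserving_measurable T2).
  have m1 := @leb_measurable_itv R `[(- 1), 1[.
  have m2 := @leb_measurable_itv R `[1, n.+1.*2.+1%:R[.
  have gL2 : in_Lp p `[1, n.+1.*2.+1%:R[ g.
    apply: (in_Lp_ae p1 mTI m2 _ phigL); apply: aeW => x.
    rewrite /I /preimage /= !in_itv/= doubleS -(natr1 n.*2.+2) -(natr1 n.*2.+1) => /andP[x1 xn].
    split; first by apply/andP; split; lra.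
    by rewrite -gphi; [(congr g; ring)|lra].
  apply: (in_LpS p1 (measurableU _ _ m1 m2) (leb_measurable_itv _) _
    (in_Lp_setU p1 m1 m2 gL gL2)) => x /=; rewrite !in_itv/= => /andP[-> ->].
  by rewrite andbT /=; apply/orP; case: ltP.
move=> T T1; pose n := Num.truncn T.
apply: (in_LpS p1 (leb_measurable_itv _) (leb_measurable_itv _) _ (H n)) => x /=.
rewrite !in_itv/= => /andP[/ltW -> /lt_trans]; apply.
rewrite (lt_le_trans (Num.Theory.truncnS_gt T))// ler_nat ltnS -addnn.
exact: leq_addr.
Qed.

(** The wave is built from the solution [g] of the delay equation
    [g (t + 2) = phi (g t)], with [f = - g]. *)
Lemma solvable_of_superposition p (Sigma : set (R * R)) (phi : R -> R) : (1 <= p)%E ->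
  (forall (D : set LT) (f : LT -> R), measurable D -> (0 < leb R D)%E ->
    (leb R D < +oo)%E -> in_Lp p D f -> in_Lp p D (phi \o f)) ->
  fun_graph phi `<=` @rotation R @` Sigma -> solvable_in_Xp p Sigma.
Proof.
move=> p1 phiL phiS z0 z1 [/= [z0L [v [vL vz0]] [w [cw z0w w0]]] z1L].
have m01 := @leb_measurable_itv R `]0, 1[.
have iv := in_Lp_integrable p1 m01 (leb_itv_fin _ _ _ _) vL.
have wE := primitive_of_weak_derivative z0L.1 iv vz0 cw z0w w0.
have [g0 g0L g0E] := in_Lp_initial p1 vL z1L.
have [g [gg0 gphi]] := delay_extension phi g0.
have mI := @leb_measurable_itv R `[(- 1), 1[.
have gL1 : in_Lp p `[(- 1), 1[ g.
  apply: (in_Lp_ae p1 mI mI _ g0L); apply: aeW => x xI; split => //.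
  exact/esym/gg0.
have gL := in_Lp_delay p1 phiL gphi gL1.
pose f (x : R) := - g x.
have ig (a b : R) : - 1 <= a -> - 1 < b -> (leb R).-integrable `]a,
  b[ (EFin \o (g : LT -> R)).
  move=> a1 b1; apply: (in_Lp_integrable p1 (leb_measurable_itv _)
    (leb_itv_fin _ _ _ _)).
  apply: (in_LpS p1 _ _ _ (gL b b1)); [exact: leb_measurable_itv..|].
  by move=> x /=; rewrite !in_itv/= => /andP[ax ->]; rewrite (le_lt_trans a1).
exists (fun t x => (Num.sqrt 2)^-1 * int0 f (t + x) + (Num.sqrt 2)^-1 * int0 g (t - x)).
exists f, g; split.
- split=> // T T0; have mT := @leb_measurable_itv R `]0, T[.
  have gT : in_Lp p `]0, T[ g.
    apply: (in_LpS p1 (leb_measurable_itv _) mT _ (gL T (lt_trans (ltrN10 _) T0))).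
    by move=> x /=; rewrite !in_itv/= => /andP[x0 ->]; rewrite (lt_trans (ltrN10 _) x0).
  apply: (in_Lp_ae p1 mT mT _ (in_Lp_lincomb (- 1) 0 p1 mT gT gT)).
  by apply: aeW => x xT; split => //; rewrite mulN1r mul0r addr0.
- by [].
- apply: aeW => t t0; split.
    rewrite addr0 subr0 -mulrDr /int0 t0.
    have it := ig 0 t (ltW (ltrN10 _)) (lt_le_trans (ltrN10 _) t0).
    rewrite (_ : \int[leb R]_(y in `]0, t[) f y = -1 * \int[leb R]_(y in `]0, t[) g y).
      by rewrite mulN1r addNr mulr0.
    rewrite -(RintegralZl (-1) (leb_measurable_itv _) it).
    by apply: eq_Rintegral => y _; rewrite mulN1r.
  have [|xi Sxi xiE] := phiS (g (t - 1), - f (t + 1)).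
    rewrite /fun_graph /= opprK -gphi; [(congr g; ring)|lra].
  by rewrite -(rotation_inj (etrans xiE (esym (rotation_dalembert f g t)))).
- have g01 (y : R) : y \in `]0, 1[ -> g y = g0 y /\ g (- y) = g0 (- y).
    rewrite in_itv/= => /andP[y0 y1].
    by clear -gg0 y0 y1; split; apply: gg0; rewrite in_itv/=; apply/andP; split; lra.
  have s0 := @sqrt2_neq0 R; have s2 := @sqr_sqrt2 R.
  apply: leb_aeS (leb_aeI z0w (leb_aeI (ae_neq 0) (ae_neq 1))) => x [zx [x0 x1]].
  rewrite in_itv/= => /andP[x0' x1'].
  have x01 : x \in `]0, 1[ by rewrite in_itv/= !lt_neqAle eq_sym x0 x1 x0' x1'.
  have xcc : x \in `[0, 1] by rewrite in_itv/= x0' x1'.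
  split; last first.
    rewrite /dalembert_t add0r sub0r /f.
    have [-> ->] := g01 _ x01; have [-> ->] := g0E _ x01.
    by field: s2.
  rewrite zx// wE// add0r sub0r -mulrDr int0_dalembert//.
  - have mx := @leb_measurable_itv R `]0, x[.
    have ivx : (leb R).-integrable `]0, x[ (EFin \o v).
      apply: (integrableS m01 mx _ iv) => y /=; rewrite !in_itv/= => /andP[-> yx].
      exact: lt_le_trans x1'.
    rewrite (_ : \int[leb R]_(y in `]0, x[) (f y - g (- y)) =
        \int[leb R]_(y in `]0, x[) (2 / Num.sqrt 2 * v y)).
      by rewrite (RintegralZl _ mx ivx) mulrA; field: s2.
    apply: eq_Rintegral => y; rewrite inE/= in_itv/= => /andP[y0 yx].
    have y01 : y \in `]0, 1[ by rewrite in_itv/= y0 (lt_le_trans yx).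
    rewrite /f; have [-> ->] := g01 _ y01; have [-> ->] := g0E _ y01.
    by ring.
  - have := ig 0 x (ltW (ltrN10 _)) (lt_le_trans (ltrN10 _) x0').
    by move=> /integrableN; apply: eq_integrable; [exact: leb_measurable_itv|].
  - by apply: ig; [rewrite lerN2|exact: ltrN10].
Qed.

End existence.

(** * The delay relation satisfied by solutions *)
Section necessity.
Context {R : realType}.
Local Notation LT := (lebesgueTypeR R).

(** The primitive is its own continuous representative, and it is bounded. *)
Lemma primitive_in_W1pstar p (v : LT -> R) : (1 <= p)%E -> in_Lp p `]0, 1[ v ->
  in_W1pstar p (fun x => \int[leb R]_(y in `]0, x[) v y).
Proof.
move=> p1 vL; have m01 := @leb_measurable_itv R `]0, 1[.
have iv := in_Lp_integrable p1 m01 (leb_itv_fin _ _ _ _) vL.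
pose V (x : R) := \int[leb R]_(y in `]0, x[) v y.
have cV : {within `[0, 1], continuous V} by exact: primitive_continuous.
split.
- have mV : lebesgue_measurable_fun `]0, 1[ V.
    have iV := within_continuous_integrable cV (measurable_itv `]0, 1[)
      (@subset_itv_oo_cc _ _ _ _).
    apply: borel_leb_measurable_fun; first exact: measurable_itv.
    by apply/measurable_EFinP; exact: (measurable_int lebesgue_measure iV).
  have [M [Mr MP]] := compact_bounded (continuous_compact cV (@segment_compact R 0 1)).
  have V1 := in_Lp_cst 1 p1 m01 (leb_itv_fin _ _ _ _).
  apply: (@in_Lp_dominated R p _ _ _ _ _ V `|M + 1| p1 (normr_ge0 _) m01 m01 m01 mV _ V1 V1).
  apply: aeW => x x01; rewrite !patchE mem_set// normr1.
  rewrite (@le_trans _ _ (M + 1))//.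
    by apply: (MP (M + 1)); [rewrite ltrDl|exists x => //; exact: subset_itv_oo_cc].
  by rewrite (le_trans (ler_norm _))// mulrDr mulr1 lerDl.
- by exists v; split => //; exact: weak_derivative_primitive.
- exists V; split => //; last by rewrite /V set_itv_ge ?Rintegral_set0// bnd_simp ltxx.
  by apply: aeW.
Qed.

(** The data [(z0, z1)] are chosen so that [g = g0] on [(-1, 1)] for every solution.
    The recovery of [g] on [(-1, 1)] rests on [ae_eq0_primitive], applied to the
    Dirichlet condition and to the initial position; the boundary condition for
    times in [(0, 2)] then provides the partner [g1], which inherits its
    integrability from [f]. *)
Lemma solvable_delay p (Sigma : set (R * R)) (g0 : LT -> R) : (1 <= p)%E ->
  solvable_in_Xp p Sigma -> in_Lp p `](- 1), 1[ g0 ->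
  exists g1 : LT -> R, in_Lp p `](- 1), 1[ g1 /\
    {ae leb R, forall t, t \in `](- 1), 1[ -> (@rotation R @` Sigma) (g0 t, g1 t)}.
Proof.
move=> p1 solv g0L; pose s : R := (Num.sqrt 2)^-1.
have s0 := @sqrt2_neq0 R; have s2 := @sqr_sqrt2 R.
have m01 := @leb_measurable_itv R `]0, 1[.
have mN11 := @leb_measurable_itv R `](- 1), 1[.
have g0P : in_Lp p `]0, 1[ g0.
  apply: (in_LpS p1 mN11 m01 _ g0L) => x /=; rewrite !in_itv/= => /andP[x0 ->].
  by rewrite (lt_trans (ltrN10 _) x0).
have g0N : in_Lp p `]0, 1[ (g0 \o -%R).
  have := in_Lp_comp p1 leb_preservingN mN11 g0L; rewrite opp_preimage_oo opprK => H.
  apply: (in_LpS p1 mN11 m01 _ H) => x /=; rewrite !in_itv/= => /andP[x0 ->].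
  by rewrite (lt_trans (ltrN10 _) x0).
(* These are the equations of [in_Lp_initial] solved for [v] and [z1]. *)
pose v (x : R) := (- s) * g0 x + (- s) * g0 (- x).
pose z1 (x : R) := (- s) * g0 x + s * g0 (- x).
have vL : in_Lp p `]0, 1[ v := in_Lp_lincomb (- s) (- s) p1 m01 g0P g0N.
have z1L : in_Lp p `]0, 1[ z1 := in_Lp_lincomb (- s) s p1 m01 g0P g0N.
pose z0 (x : R) := \int[leb R]_(y in `]0, x[) v y.
have z01X : Xp p (z0, z1) by split => //=; exact: primitive_in_W1pstar.
have [z [f [g [[fL gL] zE bc ic]]]] := solv _ _ z01X.
have iv := in_Lp_integrable p1 m01 (leb_itv_fin _ _ _ _) vL.
have iff : (leb R).-integrable `]0, 1[ (EFin \o (f : LT -> R)).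
  exact: (in_Lp_integrable p1 m01 (leb_itv_fin _ _ _ _) (fL 1 ltr01)).
have gL1 : in_Lp p `](- 1), 1[ (g : LT -> R) by apply: gL; lra.
have ig1 := in_Lp_integrable p1 mN11 (leb_itv_fin _ _ _ _) gL1.
have ig : (leb R).-integrable `]0, 1[ (EFin \o (g : LT -> R)).
  apply: (integrableS mN11 m01 _ ig1) => x /=; rewrite !in_itv/= => /andP[x0 ->].
  by rewrite (lt_trans (ltrN10 _) x0).
have igN : (leb R).-integrable `](- 1), 0[ (EFin \o (g : LT -> R)).
  apply: (integrableS mN11 (leb_measurable_itv _) _ ig1) => x /=;
    rewrite !in_itv/= => /andP[-> x0].
  by rewrite (lt_trans x0 ltr01).
have fgN : {ae leb R, forall x, x \in `]0, 1[ -> f x + g x = 0}.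
  have ifg : (leb R).-integrable `]0, 1[ (EFin \o (fun x : LT => f x + g x)).
    by have := integrableD m01 iff ig; apply: eq_integrable.
  apply: (ae_eq0_primitive ifg); apply: leb_aeS bc => x bcx.
  rewrite in_itv/= => /andP[x0 x1]; have mx := @leb_measurable_itv R `]0, x[.
  have sub : (`]0, x[%classic : set LT) `<=` `]0, 1[.
    by move=> y /=; rewrite !in_itv/= => /andP[-> /lt_trans]; apply.
  rewrite (RintegralD mx (integrableS m01 mx sub iff) (integrableS m01 mx sub ig)).
  have [+ _] := bcx (ltW x0); rewrite zE ?ltW// ?in_itv/= ?lexx ?ler01//.
  rewrite addr0 subr0 -mulrDr /int0 (ltW x0) => /eqP; rewrite mulf_eq0.
  by rewrite invr_eq0 (negbTE s0) => /eqP.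
have fgv : {ae leb R, forall x, x \in `]0, 1[ -> f x - g (- x) - Num.sqrt 2 * v x = 0}.
  have igN' :=
    leb_integrable_comp leb_preservingN (@leb_measurable_itv R `](- 1), 0[) igN.
  have igN1 : (leb R).-integrable `]0, 1[ (EFin \o (fun x : LT => g (- x))).
    by move: igN'; rewrite opp_preimage_oo oppr0 opprK; exact.
  have ifg : (leb R).-integrable `]0, 1[ (EFin \o (fun x : LT => f x - g (- x))).
    by have := integrableB m01 iff igN1; apply: eq_integrable.
  have isv := integrableZl m01 (Num.sqrt 2) iv.
  have ifgv : (leb R).-integrable `]0, 1[
      (EFin \o (fun x : LT => f x - g (- x) - Num.sqrt 2 * v x)).
    by have := integrableB m01 ifg isv; apply: eq_integrable.
  apply: (ae_eq0_primitive ifgv); apply: leb_aeS ic => x icx x01.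
  have [+ _] := icx (subset_itv_oo_cc x01).
  move: (x01); rewrite in_itv/= => /andP[x0 x1].
  have mx := @leb_measurable_itv R `]0, x[.
  have sub : (`]0, x[%classic : set LT) `<=` `]0, 1[.
    by move=> y /=; rewrite !in_itv/= => /andP[-> /lt_trans]; apply.
  rewrite zE//; last exact: subset_itv_oo_cc.
  rewrite add0r sub0r -mulrDr int0_dalembert ?(ltW x0)//.
  - move=> E; rewrite (RintegralB mx (integrableS m01 mx sub ifg)).
      rewrite (RintegralZl _ mx (integrableS m01 mx sub iv)).
      by rewrite -/(z0 x) -E mulVKf ?subrr.
    have := integrableS m01 mx sub isv.
    by apply: eq_integrable.
  - exact: integrableS m01 mx sub iff.
  - apply: (integrableS (leb_measurable_itv _) (leb_measurable_itv _) _ igN) => y /=.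
    rewrite !in_itv/= => /andP[xy ->]; rewrite andbT (lt_trans _ xy)//.
    by rewrite ltrN2.
have gg0 : {ae leb R, forall x, x \in `]0, 1[ -> g x = g0 x /\ g (- x) = g0 (- x)}.
  apply: leb_aeS (leb_aeI fgN (leb_aeI fgv ic)) => x [fgx [fvx icx]] x01.
  have [_] := icx (subset_itv_oo_cc x01).
  move: (fgx x01) (fvx x01); rewrite /dalembert_t add0r sub0r /v /z1 => e1 e2 e3.
  have e2' : f x - g (- x) + g0 x + g0 (- x) = 0.
    by rewrite -[RHS]e2 /s; field.
  have e3' : f x + g (- x) = - g0 x + g0 (- x).
    by rewrite -[LHS](divfK s0) e3 /s; field.
  by clear -e1 e2' e3'; split; lra.
have gg0' : {ae leb R, forall t, t \in `](- 1), 1[ -> g t = g0 t}.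
  apply: leb_aeS (leb_aeI (ae_neq 0)
    (leb_aeI gg0 (leb_preserving_ae leb_preservingN gg0))).
  move=> t [t0 [H1 H2]]; rewrite in_itv/= => /andP[tl tr].
  move: t0; rewrite neq_lt => /orP[t0|t0].
    have := H2 _; rewrite in_itv/= opprK => -[]//.
    by rewrite oppr_gt0 t0 ltrNl tl.
  by have [] := H1 _; rewrite ?in_itv/= ?t0.
pose g1 (t : R) := - f (2 + t).
exists g1; split.
  have f4 : in_Lp p `]0, 4[ f by apply: fL.
  have m4 := @leb_measurable_itv R `]0, 4[.
  have T2 := @leb_preservingD R 2.
  have fT := in_Lp_comp p1 T2 m4 f4.
  have mT : measurable (+%R (2 : R) @^-1` `]0, 4[ : set LT).
    by rewrite -[X in measurable X]setTI; exact: (leb_preserving_measurable T2).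
  apply: (in_Lp_ae p1 mT mN11 _ (in_Lp_lincomb (- 1) 0 p1 mT fT fT)).
  apply: aeW => x /=; rewrite !in_itv/= => /andP[xl xr]; split.
    by clear -xl xr; apply/andP; split; lra.
  by rewrite mulN1r mul0r addr0.
have bc1 := leb_preserving_ae (leb_preservingD 1) bc.
apply: leb_aeS (leb_aeI gg0' bc1) => t [gt bct] t1.
move: (t1); rewrite in_itv/= => /andP[tl tr].
rewrite -gt//; have [|_ Sd] := bct; first by rewrite -lerBlDl sub0r ltW.
exists (dalembert_t f g (1 + t) 1, - dalembert_x f g (1 + t) 1) => //.
rewrite rotation_dalembert /g1; congr (g _, - f _); ring.
Qed.

End necessity.

(** * Selections of the rotated set *)
Section selections.
Context {R : realType}.
Local Notation LT := (lebesgueTypeR R).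
Context (p : \bar R) (Sigma : set (R * R)).
Context (p1 : (1 <= p)%E) (solv : solvable_in_Xp p Sigma).
Local Notation RS := (@rotation R @` Sigma).
Let mN11 : measurable (`](- 1), 1[%classic : set LT) := @leb_measurable_itv R _.

(** Take [g0] constant equal to [y]. *)
Lemma sections_nonempty (y : R) : exists w, RS (y, w).
Proof.
have [g1 [_ H]] := solvable_delay p1 solv (in_Lp_cst y p1 mN11 (leb_itv_fin _ _ _ _)).
have N11 : (-1 : R) < 1 by rewrite (lt_trans (ltrN10 _) ltr01).
by have [t _ Ht] := ae_exists_oo N11 H; exists (g1 t).
Qed.

(** A selection that is within [1] of the least possible absolute value has the
    slowest growth that any selection can have, up to that constant. *)
Lemma near_minimal_selection : exists phi : R -> R,
  forall y, RS (y, phi y) /\ forall w, RS (y, w) -> `|phi y| <= `|w| + 1.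
Proof.
suff /choice[phi H] : forall y, exists w,
    RS (y, w) /\ forall w', RS (y, w') -> `|w| <= `|w'| + 1 by exists phi.
move=> y; have [w0 w0S] := sections_nonempty y.
pose A := [set `|w| | w in [set w | RS (y, w)]].
have Ainf : has_inf A.
  by split; [exists `|w0|, w0|exists 0 => _ [w _ <-]].
have [_ [w wS <-] wlt] := inf_adherent ltr01 Ainf.
exists w; split => // w' w'S; apply: ltW; apply: (lt_le_trans wlt).
by rewrite lerD2r; apply: ge_inf; [exact: Ainf.2|exists w'].
Qed.

(** With [g0 t = c + t], the partner [g1] translated by [c] is a measurable
    selection almost everywhere on [(c - 1, c + 1)]. These selections are glued
    along the intervals [[c, c + 1)], [c] an integer, and corrected on a null
    set, which completeness makes harmless. Translations suffice, and they keep
    [g0] bounded, which works for every exponent. *)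
Lemma lebesgue_measurable_selection : exists phi : R -> R,
  lebesgue_measurable_fun setT phi /\ fun_graph phi `<=` RS.
Proof.
have cL (c : int) : in_Lp p `](- 1), 1[ (fun t : LT => c%:~R + t).
  have mc : lebesgue_measurable_fun `](- 1), 1[ (fun t : LT => c%:~R + t).
    apply: borel_leb_measurable_fun; first exact: measurable_itv.
    exact: measurable_funD (measurable_cst _) (@measurable_id _ _ _).
  have V1 := in_Lp_cst 1 p1 mN11 (leb_itv_fin _ _ _ _).
  have c0 : 0 <= `|c%:~R : R| + 1 by rewrite addr_ge0.
  apply: (in_Lp_dominated p1 c0 mN11 mN11 mN11 mc _ V1 V1).
  apply: aeW => x x01; rewrite !patchE mem_set// normr1 mulrDr mulr1.
  rewrite (le_trans (ler_normD _ _))// -[leRHS]addrA lerD2l.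
  rewrite -[leLHS]addr0 lerD ?addr_ge0//.
  by move: x01; rewrite /= in_itv/= -ltr_norml; exact: ltW.
have /choice[G HG] c := solvable_delay p1 solv (cL c).
have /choice[sig sigS] := sections_nonempty.
pose psi (y : R) := G (Num.floor y) (- (Num.floor y)%:~R + y).
pose phi (y : R) := if `[< RS (y, psi y) >] then psi y else sig y.
exists phi; split; last first.
  by move=> [y w]; rewrite /fun_graph /= => ->; rewrite /phi; case: asboolP =>
    // _; exact: sigS.
move=> _ Y mY; rewrite setTI.
rewrite (_ : _ @^-1` Y =
  \bigcup_(c : int) (`[(c%:~R : R), c%:~R + 1[%classic `&` phi @^-1` Y)).
  apply: countable_bigcupT_measurable => // c.
  have mc := @leb_measurable_itv R `[c%:~R, c%:~R + 1[.
  have T2 := @leb_preservingD R (- c%:~R).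
  have [GL Gae] := HG c.
  have mT : measurable (+%R (- c%:~R : R) @^-1` `](- 1), 1[ : set LT).
    by rewrite -[X in measurable X]setTI; exact: (leb_preserving_measurable T2).
  have mGc := (in_Lp_comp p1 T2 mN11 GL).1.
  apply: (leb_measurable_fun_ae mT mc _ mGc) => //.
  apply: leb_aeS (leb_preserving_ae T2 Gae) => y; rewrite addrA subrr add0r => Hy.
  rewrite /= in_itv/= => /andP[cy yc].
  have fy : Num.floor y = c by apply: floor_def; rewrite cy intrD1.
  have yI : - c%:~R + y \in `](- 1), 1[ by rewrite in_itv/=; apply/andP; split; lra.
  split; first exact: yI.
  by rewrite /phi /psi fy asboolT//; exact: Hy.
apply/seteqP; split=> [y Yy|y [c _ []]//].
exists (Num.floor y) => //; split => //.
by rewrite /= in_itv/= -intrD1 floor_itv.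
Qed.

End selections.

(** * Step functions on shrinking dyadic blocks *)
Section growth.
Context {R : realType}.
Local Notation LT := (lebesgueTypeR R).
Implicit Types (y r : R^nat).

Definition dyadic (k : nat) : R := (2 ^ k.+1)%:R^-1.

(** The intervals [(2^-(k+1), 2^-k)] are disjoint; [r k <= 1] tunes the length of
    the block, which starts at the left end of the [k]-th one. *)
Definition dyadic_block r (k : nat) : interval R :=
  `]dyadic k, dyadic k * (1 + r k)[.

Lemma dyadic_gt0 k : 0 < dyadic k.
Proof. by rewrite invr_gt0 ltr0n expn_gt0. Qed.

Lemma dyadicS k j : (k < j)%N -> dyadic j * 2 <= dyadic k.
Proof.
move=> kj; rewrite /dyadic expnS natrM invfM mulrAC mulVf ?pnatr_eq0// mul1r.
by rewrite lef_pV2 ?posrE ?ltr0n ?expn_gt0// ler_nat leq_exp2l.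
Qed.

Lemma dyadic_le_half k : dyadic k * 2 <= 1.
Proof.
rewrite /dyadic expnS natrM invfM mulrAC mulVf ?pnatr_eq0// mul1r.
by rewrite invf_le1 ?ltr0n ?expn_gt0// ler1n expn_gt0.
Qed.

Lemma dyadic_block_inj r k j (t : R) : (forall n, r n <= 1) ->
  t \in dyadic_block r k -> t \in dyadic_block r j -> k = j.
Proof.
move=> r1; wlog kj : k j / (k < j)%N => [H|].
  by case: (ltngtP k j) => // kj tk tj; [exact: H|exact/esym/H].
rewrite !in_itv/= => /andP[tk _] /andP[_ tj].
have : t < dyadic k.
  apply: (lt_le_trans tj); apply: le_trans (dyadicS kj).
  by rewrite ler_pM2l ?dyadic_gt0//; have := r1 j; lra.
by move=> /(lt_trans tk); rewrite ltxx.
Qed.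

Lemma dyadic_block_sub r k : r k <= 1 -> [set` dyadic_block r k] `<=` `](- 1), 1[.
Proof.
move=> r1 t /=; rewrite !in_itv/= => /andP[tl tr]; apply/andP; split.
  by rewrite (lt_trans _ tl)// (lt_trans (ltrN10 _))// dyadic_gt0.
apply: (lt_le_trans tr); apply: le_trans (dyadic_le_half k).
by rewrite ler_pM2l ?dyadic_gt0//; lra.
Qed.

Lemma leb_dyadic_block r k : 0 < r k ->
  leb R [set` dyadic_block r k] = (dyadic k * r k)%:E.
Proof.
move=> r0; rewrite leb_itv lebesgue_measure_itv/= lte_fin.
have d0 := dyadic_gt0 k.
rewrite ltr_pMr// ltrDl r0 -EFinB; congr EFin; ring.
Qed.

(** Prescribed values [y k] on blocks of prescribed lengths: this is how a sequence
    of bad points for the growth of selections is turned into one function. *)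
Lemma dyadic_step_function y r : (forall k, r k <= 1) ->
  exists g : LT -> R, [/\ measurable_fun setT g,
    forall k (t : R), t \in dyadic_block r k -> g t = y k &
    forall t : R, (forall k, t \notin dyadic_block r k) -> g t = 0].
Proof.
move=> r1.
have /choice[g Hg] (t : LT) : exists s : R,
    (forall k, t \in dyadic_block r k -> s = y k) /\
    ((forall k, t \notin dyadic_block r k) -> s = 0).
  have [[k tk]|tN] := pselect (exists k, t \in dyadic_block r k).
    exists (y k); split=> [j tj|/(_ k)]; last by rewrite tk.
    by rewrite (dyadic_block_inj r1 tk tj).
  exists 0; split=> // k tk; exfalso; apply: tN; by exists k.
exists g; split; last 2 first.
- by move=> k t; exact: (Hg t).1.
- by move=> t; exact: (Hg t).2.
move=> _ Y mY; rewrite setTI.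
pose U : set LT := \bigcup_k [set` dyadic_block r k].
have mU : measurable U.
  by apply: bigcupT_measurable => k; exact: leb_measurable_itv.
rewrite (_ : g @^-1` Y =
    (\bigcup_k (if `[< Y (y k) >] then [set` dyadic_block r k] else set0)) `|`
    (if `[< Y 0 >] then ~` U else set0)).
  apply: measurableU.
    apply: bigcupT_measurable => k; case: ifP => _; last exact: measurable0.
    exact: leb_measurable_itv.
  by case: ifP => _; [exact: measurableC|exact: measurable0].
apply/seteqP; split=> [t Yt|t [[k _]|]].
- have [[k _ tk]|tN] := pselect (U t).
    by left; exists k => //; rewrite asboolT// -((Hg t).1 k tk).
  right; rewrite asboolT// -((Hg t).2 _)// => k.
  by apply/negP => tk; apply: tN; exists k.
- by case: asboolP => // Yk tk; rewrite /preimage/= ((Hg t).1 k tk).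
- case: asboolP => // Y0 tN; rewrite /preimage/= ((Hg t).2 _)// => k.
  by apply/negP => tk; apply: tN; exists k.
Qed.

End growth.

(** * Selections with controlled growth *)
Section growth_selections.
Context {R : realType}.
Local Notation LT := (lebesgueTypeR R).
Context (p : \bar R) (Sigma : set (R * R)).
Context (p1 : (1 <= p)%E) (solv : solvable_in_Xp p Sigma).
Local Notation RS := (@rotation R @` Sigma).
Let mN11 : measurable (`](- 1), 1[%classic : set LT) := @leb_measurable_itv R _.

(** If the near-minimal selection were unbounded on a bounded set, a step function
    taking values [y k] in that set would be bounded, while its partner would
    exceed [k] in absolute value on the [k]-th block, which has positive
    measure. *)
Lemma bounded_to_bounded_selection : p = +oo%E -> exists phi : R -> R,
  bounded_to_bounded phi /\ fun_graph phi `<=` RS.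
Proof.
move=> poo; have [phi Hphi] := near_minimal_selection p1 solv.
exists phi; split; last first.
  by move=> [y w]; rewrite /fun_graph /= => ->; exact: (Hphi y).1.
move=> B [M [_ BM]]; apply: contrapT => phiB.
have BM1 (y : R) : B y -> `|y| <= `|M| + 1.
  by apply: BM; rewrite (le_lt_trans (ler_norm _))// ltrDl.
have /choice[y Hy] (k : nat) : exists y : R, B y /\ k.+1%:R < `|phi y|.
  apply: contrapT => /forallNP yN; apply: phiB.
  exists k.+1%:R; split; first exact: num_real.
  move=> N kN _ [y By <-]; apply: le_trans (ltW kN).
  by rewrite leNgt; apply/negP => ky; exact: (yN y).
have [g0 [mg0 g0y g00]] := dyadic_step_function y (fun k : nat => lexx (1 : R)).
have g0L : in_Lp p `](- 1), 1[ g0.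
  have mg : lebesgue_measurable_fun `](- 1), 1[ g0 by exact: measurable_funTS.
  have V1 := in_Lp_cst 1 p1 mN11 (leb_itv_fin _ _ _ _).
  have M0 : 0 <= `|M| + 1 by rewrite addr_ge0.
  apply: (in_Lp_dominated p1 M0 mN11 mN11 mN11 mg _ V1 V1).
  apply: aeW => t tI; rewrite !patchE mem_set// normr1 mulrDr mulr1.
  have [[k tk]|tN] := pselect (exists k, t \in dyadic_block (fun=> 1) k).
    by rewrite (g0y _ _ tk) (le_trans (BM1 _ (Hy k).1))// lerDl.
  rewrite g00 ?normr0 ?addr_ge0// => k.
  by apply/negP => tk; apply: tN; exists k.
have [g1 [g1L Hg]] := solvable_delay p1 solv g0L.
move: g1L; rewrite poo => -[_ /Lnormy_ltyP[N g1N]].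
pose k := (Num.truncn N).+1.
have dk : dyadic k < dyadic k * (1 + 1) :> R.
  by rewrite ltr_pMr ?dyadic_gt0// ltrDl.
have [|t tk [g1t St]] := @ae_exists_oo _ (fun t => `|g1 t| <= N /\ RS (g0 t,
  g1 t)) _ _ dk.
  apply: leb_aeS (leb_aeI g1N Hg) => t [tN tS] tk.
  have tI := @dyadic_block_sub _ (fun=> 1) k (lexx _) t tk.
  by move: tN; rewrite patchE mem_set//; split => //; exact: tS.
move: St; rewrite (g0y k t tk) => /(Hphi (y k)).2 phik.
have := lt_le_trans (Hy k).2 phik; rewrite -natr1 ltrD2r => /lt_le_trans /(_ g1t).
by rewrite ltNge ltW// /k Num.Theory.truncnS_gt.
Qed.

(** Otherwise every pair [(y k, w)] in the rotated set satisfies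
    [|w| > C k * (1 + |y k|)] for some [y k], with [C k = 2^(k+1) * (k+1)]. The
    [k]-th block has length [2^-(k+1) / (1 + |y k|)^q]: it contributes at most
    [2^-(k+1)] to the integral of [|g0|^q], which is thus finite, and at least
    [C k ^ q / 2^(k+1) >= k + 1] to that of [|g1|^q], which is thus infinite. *)
Lemma linear_growth_selection : (p < +oo)%E -> exists phi : R -> R,
  linear_growth phi /\ fun_graph phi `<=` RS.
Proof.
move=> poo; have [phi Hphi] := near_minimal_selection p1 solv.
exists phi; split; last first.
  by move=> [y w]; rewrite /fun_graph /= => ->; exact: (Hphi y).1.
have [q pE] : exists q : R, p = q%:E.
  by case: p p1 poo => [q| |]//; exists q.
have q1 : 1 <= q by move: p1; rewrite pE lee_fin.
have q0 : 0 < q by exact: lt_le_trans q1.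
apply: contrapT => phiN.
pose C (k : nat) : R := (2 ^ k.+1)%:R * k.+1%:R.
have C1 k : 1 <= C k by rewrite /C -natrM ler1n muln_gt0 expn_gt0.
have /choice[y Hy] (k : nat) : exists y : R, C k * (1 + `|y|) + 1 < `|phi y|.
  apply: contrapT => /forallNP yN; apply: phiN.
  have C0 : 0 <= C k by exact: le_trans (C1 k).
  exists (C k), (C k + 1); split => //; first by rewrite addr_ge0.
  move=> y; rewrite leNgt; apply/negP => ky; apply: (yN y).
  by apply: le_lt_trans ky; rewrite mulrDr mulr1 addrA [_ + C k]addrC.
have y1 k : 1 <= 1 + `|y k| by rewrite lerDl.
have y0 k : 0 < 1 + `|y k| by apply: lt_le_trans (y1 k).
pose r (k : nat) : R := ((1 + `|y k|) `^ q)^-1.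
have yq1 k : 1 <= (1 + `|y k|) `^ q.
  have := @ge0_ler_powR R q (ltW q0) 1 (1 + `|y k|).
  by rewrite !nnegrE ler01 (ltW (y0 k)) powR1; exact.
have yq0 k : 0 < (1 + `|y k|) `^ q by apply: lt_le_trans (yq1 k).
have r0 k : 0 < r k by rewrite invr_gt0.
have r1 k : r k <= 1 by rewrite invf_le1.
have [g0 [mg0 g0y g00]] := dyadic_step_function y r1.
have mI k := @leb_measurable_itv R (dyadic_block r k).
have g0L : in_Lp p `](- 1), 1[ g0.
  apply: (in_LpS p1 measurableT mN11 (@subsetT _ _)).
  split; first exact: mg0.
  rewrite pE; apply/(Lnorm_ltyP _ q0); rewrite patch_setT.
  pose u k (t : LT) : \bar R :=
    ((`|y k| `^ q)%:E * (\1_[set` dyadic_block r k] t)%:E)%E.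
  have u0 k t : setT t -> (0 <= u k t)%E by move=> _;
    rewrite mule_ge0// lee_fin ?powR_ge0.
  have mu_ k : measurable_fun setT (u k).
    apply: emeasurable_funM; first exact: measurable_cst.
    by apply/measurable_EFinP; exact: measurable_indic.
  apply: (@le_lt_trans _ _ (\int[leb R]_t (\sum_(k <oo) u k t))%E).
    have mS : measurable_fun setT (fun t : LT => (\sum_(k <oo) u k t)%E).
      by apply: ge0_emeasurable_sum => // k t Ht _; exact: u0.
    apply: (@ge0_le_integral _ _ _ (leb R) setT measurableT _ _ _
      (measurable_normr_powR q mg0) mS).
      by move=> t _; rewrite lee_fin powR_ge0.
    move=> t _; have [[k tk]|tN] := pselect (exists k, t \in dyadic_block r k).
      have -> : ((`|g0 t| `^ q)%:E = u k t)%E.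
        by rewrite (g0y _ _ tk) /u indicE mem_set// mule1.
      apply: le_trans (nneseries_lim_ge k.+1 _); last by move=> n _ _; exact: u0.
      rewrite big_nat_recr//= leeDr// sume_ge0// => n _; exact: u0.
    rewrite g00 => [|k]; last by apply/negP => tk; apply: tN; exists k.
    rewrite normr0 powR0 ?gt_eqF//; apply: nneseries_ge0 => n _ _; exact: u0.
  rewrite (integral_nneseries (leb R) measurableT mu_ u0).
  apply: (@le_lt_trans _ _ 1%:E); last exact: ltry.
  apply: le_trans (epsilon_trick0 xpredT ler01).
  apply: lee_nneseries => [k _ _|k _].
    by apply: integral_ge0 => t tT; exact: u0.
  have indE : (\int[leb R]_t (\1_[set` dyadic_block r k] t)%:E = (dyadic k * r k)%:E)%E.
    rewrite (@integral_indic _ _ _ (leb R) setT measurableT _ (mI k)) setIT.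
    exact: leb_dyadic_block.
  have m1 : measurable_fun setT (fun t : LT =>
    (\1_[set` dyadic_block r k] t)%:E : \bar R).
    by apply/measurable_EFinP; exact: measurable_indic (mI k).
  have ind0 (t : LT) : setT t -> (0 <= ((\1_[set` dyadic_block r k] t)%:E : \bar R))%E.
    by rewrite lee_fin.
  have yq : (0 <= (`|y k| `^ q)%:E)%E by rewrite lee_fin powR_ge0.
  rewrite (@ge0_integralZl _ _ _ (leb R) setT measurableT _ m1 _ ind0 yq).
  rewrite indE -EFinM lee_fin.
  rewrite mulrCA /dyadic mul1r ler_piMr ?invr_ge0 ?ler0n// /r ler_pdivrMr// mul1r.
  by rewrite ge0_ler_powR ?nnegrE ?(ltW q0) ?(ltW (y0 k))// lerDr.
have [g1 [g1L Hg]] := solvable_delay p1 solv g0L.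
move: (g1L) => [mg1]; rewrite pE => /(Lnorm_ltyP _ q0).
set J := (\int[leb R]_x _)%E => Joo.
have Jk k : (k.+1%:R%:E <= J)%E.
  have subI := @dyadic_block_sub R r k (r1 k).
  have mg1' := (lebesgue_measurable_restrict g1 mN11).1 mg1.
  have mgq := measurable_normr_powR q mg1'.
  have pow0 (t : LT) : setT t -> (0 <= (`|(g1 \_ `](-1), 1[) t| `^ q)%:E)%E.
    by rewrite lee_fin powR_ge0.
  apply: le_trans (@ge0_subset_integral _ _ _ (leb R) _ setT (mI k) measurableT _ mgq pow0 (@subsetT _ _)).
  have c0 : 0 <= C k * (1 + `|y k|).
    by rewrite mulr_ge0 ?(ltW (y0 k))// (le_trans _ (C1 k)).
  apply: (@le_trans _ _ (\int[leb R]_(t in [set` dyadic_block r k])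
    ((C k * (1 + `|y k|)) `^ q)%:E)%E).
    rewrite integral_cst// [X in (_ * X)%E](_ : _ = (dyadic k * r k)%:E); last first.
      exact: leb_dyadic_block.
    rewrite -EFinM lee_fin.
    rewrite powRM ?(ltW (y0 k)) ?(le_trans _ (C1 k))// /r.
    rewrite (_ : _ * _ * _ = C k `^ q * dyadic k); last first.
      by field; rewrite gt_eqF.
    have dC : C k * dyadic k = k.+1%:R.
      by rewrite /C /dyadic mulrAC divff ?mul1r// pnatr_eq0 -lt0n expn_gt0.
    rewrite -dC ler_pM2r ?dyadic_gt0//.
    by rewrite -[leLHS]powRr1 ?ler_powR// (le_trans _ (C1 k)).
  apply: (@ae_ge0_le_integral _ _ _ (leb R) _ (mI k)).
  - by move=> t _; rewrite lee_fin powR_ge0.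
  - exact: measurable_cst.
  - by move=> t _; exact: pow0.
  - exact: measurable_funS mgq.
  - apply: leb_aeS Hg => t Ht tk; have tI := subI t tk.
    rewrite lee_fin ge0_ler_powR ?nnegrE ?(ltW q0)// patchE mem_set//.
    have := (Hphi _).2 _ (Ht tI); rewrite (g0y k t tk) => phik.
    by have := lt_le_trans (Hy k) phik; rewrite ltrD2r => /ltW.
have J0 : (0 <= J)%E by apply: le_trans (Jk 0%N); rewrite lee_fin.
have Jfin : J \is a fin_num by rewrite ge0_fin_numE.
have := Jk (Num.truncn (fine J)); rewrite -(fineK Jfin) lee_fin leNgt.
by rewrite Num.Theory.truncnS_gt.
Qed.

End growth_selections.

Unset Implicit Arguments.

Theorem theorem20 (R : realType) (Sigma : set (R * R)) (p : \bar R)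
    (hp : (1 <= p)%E) :
  (((p < +oo)%E /\
      (exists phi : R -> R, [/\ universally_measurable_fun phi,
         linear_growth phi & fun_graph phi `<=` @rotation R @` Sigma]) \/
    p = +oo%E /\
      (exists phi : R -> R, [/\ universally_measurable_fun phi,
         bounded_to_bounded phi & fun_graph phi `<=` @rotation R @` Sigma])) ->
   solvable_in_Xp p Sigma)
  /\
  (solvable_in_Xp p Sigma ->
   (exists phi : R -> R,
      lebesgue_measurable_fun [set: R] phi /\ fun_graph phi `<=` @rotation R @` Sigma)
   /\
   ((p < +oo)%E -> exists phi : R -> R,
      linear_growth phi /\ fun_graph phi `<=` @rotation R @` Sigma)
   /\
   (p = +oo%E -> exists phi : R -> R,
      bounded_to_bounded phi /\ fun_graph phi `<=` @rotation R @` Sigma)).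
Proof.
split=> [[[poo [phi [phiU phiG phiS]]]|[pE [phi [phiU phiB phiS]]]]|solv].
- by apply: (solvable_of_superposition hp _ phiS) => D f; exact: in_Lp_linear_growth.
- apply: (solvable_of_superposition hp _ phiS) => D f.
  by rewrite pE; exact: in_Loo_bounded_to_bounded.
- split; first exact: lebesgue_measurable_selection hp solv.
  split; first exact: linear_growth_selection hp solv.
  exact: bounded_to_bounded_selection hp solv.
Qed.
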